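(* Let $\nu=\alpha-1/p$, let $x_0\in(0,1)$, let $D>0$ be the solution of $D^{2\nu+2}=\sum_{j=1}^m(n_j^2\varepsilon_j^2)\wedge(n_jD)$, take $L=(l_0+1)\vee\lceil\log_2(D)\rceil$ and set $\tau=C_{\nu,R}+\sqrt{2(2\nu+1)L}$. Then the pointwise $\ell_2$-risk of the distributed $(\boldsymbol\varepsilon,\boldsymbol\delta)$-differentially private protocol $\hat f(x_0)$ (defined in the context) satisfies $$\sup_{f\in\mathcal B^{\alpha,R}_{p,q}}\mathbb E_f\left(\hat f(x_0)-f(x_0)\right)^2\le C_\psi\log(N)\,2^{-2L\nu}$$ for a constant $C_\psi>0$ depending only on the choice of wavelet basis.
   Context: Data. There are $m$ servers; server $j$ holds $n_j$ observations $Z^{(j)}=(Z^{(j)}_i)_{i=1}^{n_j}$, $Z_i^{(j)}=(Y_i^{(j)},X_i^{(j)})\in\mathcal Z=\mathbb R\times[0,1]$. All $N=\sum_{j=1}^m n_j$ observations are i.i.d. from $P_f$, under which $X_i^{(j)}\sim U[0,1]$, $Y_i^{(j)}=f(X_i^{(j)})+\xi_i^{(j)}$, with $\xi_i^{(j)}\sim N(0,1)$ independent of $X_i^{(j)}$. Privacy. A randomized transcript $T^{(j)}$ with conditional law $\mathbb P(\cdot\mid Z^{(j)})$ on $(\mathcal T,\mathscr T)$ is $(\varepsilon_j,\delta_j)$-differentially private if $\mathbb P(T^{(j)}\in A\mid Z^{(j)}=z)\le e^{\varepsilon_j}\mathbb P(T^{(j)}\in A\mid Z^{(j)}=z')+\delta_j$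 for all $A\in\mathscr T$ and all $z,z'\in\mathcal Z^{n_j}$ differing in at most one of their $n_j$ entries. A distributed $(\boldsymbol\varepsilon,\boldsymbol\delta)$-DP protocol consists of transcripts $T^{(j)}$, each depending only on the local data $Z^{(j)}$ and being $(\varepsilon_j,\delta_j)$-differentially private, and an estimator that is a function of $(T^{(1)},\dots,T^{(m)})$. $0<\varepsilon_j\le C_\varepsilon$ for a fixed constant $C_\varepsilon$. $\mathbb E_f$ is expectation over data from $P_f$ and the transcripts. The asymptotic regime is $N\to\infty$. Function class. $p\ge2$, $q\ge1$, $\nu=\alpha-1/p>1/2$, and $R>0$ is a constant. Let $\{\psi_{lk}\}$, $l\ge l_0$, be a Cohen–Daubechies–Vial compactly supported $A$-regular orthonormal wavelet basis of $L_2[0,1]$ with $A>\alpha$ (level $l_0$ denotes the father wavelets; levels $l>l_0$ contain $2^l$ wavelets, $k=0,\dots,2^l-1$, with $\psi_{lk}(x)=2^{l/2}\psi(2^lx-k)$ away from the boundary), and $f_{lk}=\langle f,\psi_{lk}\rangle$. Then $\|f\|_{\mathcal B^\alpha_{p,q}}=\big(\sum_{l\ge l_0}(2^{l(\alpha+1/2-1/p)}\|(f_{lk})_k\|_p)^q\big)^{1/q}$ (supremum over $l$ if $q=\infty$), and $\mathcal B^{\alpha,R}_{p,q}=\{f\in L_2[0,1]:\|f\|_{\mathcal B^\alpha_{p,q}}\le R\}$. $C_{\nu,R}>0$ is a constant with $\|f\|_\infty\le C_{\nu,R}$ for all $f\in\mathcal B^{\alpha,R}_{p,q}$. The constant $c_A$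 bounds, at each level $l$, the number of basis functions $\psi_{lk}$ with overlapping support (i.e. whose support contains a given point). The protocol. For $x\in\mathbb R$, $[x]_\tau=\max(-\tau,\min(x,\tau))$. Server $j$ computes $\hat f^{(j)}_{lk;\tau}=\frac1{n_j}\sum_{i=1}^{n_j}[Y_i^{(j)}]_\tau\psi_{lk}(X_i^{(j)})$ for $l_0\le l\le L$ and all $k$ at level $l$, forms $\hat f^{(j)}_{L,\tau}(x_0)=\sum_{l=l_0}^L\sum_k\hat f^{(j)}_{lk;\tau}\psi_{lk}(x_0)$, and outputs $T^{(j)}_{L,\tau}=\hat f^{(j)}_{L,\tau}(x_0)+W^{(j)}$, where the $W^{(j)}$ are independent (and independent of the data) with the Laplace distribution $\mathrm{Lap}\big(0,\,c'_\psi\tau2^L/(n_j\varepsilon_j)\big)$ centered at $0$ with this scale parameter, $c'_\psi=2c_A\|\psi\|_\infty^2$. The estimator is $$\hat f(x_0)=\sum_{j=1}^m u_jT^{(j)}_{L,\tau},\qquad u_j=\frac{v_j}{\sum_{j'}v_{j'}},\quad v_j=(n_j^2\varepsilon_j^2)\wedge(n_j2^L).$$ $a\wedge b=\min(a,b)$, $a\vee b=\max(a,b)$.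
   Formalization: Proved for D ≥ c_0 with any fixed c_0 > 0 and for N ≥ N_0, where N_0 may depend on c_0, α, p, q, R, C_{ν,R}, C_ε but C_ψ does not; if D → 0 (e.g. m = 1, ε_1 = N^{-2}) the claimed bound fails. *)

(* Defs.v *)
From HB Require Import structures.
From mathcomp Require Import all_boot all_order all_algebra.
From mathcomp Require Import all_classical all_reals all_analysis.

Set Implicit Arguments.
Unset Strict Implicit.
Unset Printing Implicit Defensive.

Import Order.TTheory GRing.Theory Num.Theory.
Import numFieldNormedType.Exports.

Local Open Scope classical_set_scope.
Local Open Scope ring_scope.

Section Wavelets.
Context {R : realType}.
Local Notation mu := (@lebesgue_measure R).

Definition inner01 (f g : R -> R) : R := \int[mu]_(x in `[0, 1]) (f x * g x).

Definition sup_norm (g : R -> R) : R := sup [set `|g x| | x in [set: R]].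

(* The boundary functions at the right end point of [0, 1] are obtained from
   those at the left one by reflecting x to 1 - x. At scale 2^j this turns the
   translate g(2^j x - k) into (reflected g)(y - (2^j - 1 - k)), where
   y = 2^j (1 - x). *)
Definition reflected (g : R -> R) (y : R) : R := g (1 - y).

(* Cohen, Daubechies and Vial start from the functions
   sum_(n = i)^(2M - 2) 'C(n, i) phi(y + n - M + 1), i < M, restricted to the
   half line y >= 0, and orthonormalize them by Gram-Schmidt in the order
   i = M - 1, M - 2, ..., 0; the k-th boundary function is thus a combination
   of those with i >= M - 1 - k, and is supported in [0, M + k]. *)
Definition edge_raw (M : nat) (phi : R -> R) (i : nat) (y : R) : R :=
  \sum_(n < (2 * M).-1) 'C(n, i)%:R * phi (y + n%:R - M%:R + 1).

Definition edge_scaling (M : nat) (phi : R -> R) (e : nat -> R -> R) : Prop :=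
  forall k, (k < M)%N -> exists a : nat -> R, forall y : R, 0 <= y ->
    e k y = \sum_(i < M | (M <= k + i + 1)%N) a i * edge_raw M phi i y.

(* The 2^j functions at scale 2^j: M left boundary functions, the interior
   translates g(2^j x - k), and M right boundary functions. *)
Definition cdv_fun (M : nat) (g : R -> R) (gL gR : nat -> R -> R)
    (j k : nat) (x : R) : R :=
  Num.sqrt (2 ^+ j) *
  (if (k < M)%N then gL k (2 ^+ j * x)
   else if (k < 2 ^ j - M)%N then g (2 ^+ j * x - k%:R)
   else gR (2 ^ j - 1 - k)%N (2 ^+ j * (1 - x))).

Definition in_span01 (s : nat) (F : nat -> R -> R) (g : R -> R) : Prop :=
  exists c : nat -> R, forall x : R, 0 <= x <= 1 ->
    g x = \sum_(i < s) c i * F i x.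

(* [cdv_phi] and [cdv_psi] are the Daubechies father and mother wavelets with
   [cdv_M] vanishing moments and filter [cdv_h], translated so as to be
   supported in [1 - M, M]. *)
Record cdv_data := CDVData {
  cdv_A : nat;
  cdv_M : nat;
  cdv_l0 : nat;
  cdv_h : nat -> R;
  cdv_phi : R -> R;
  cdv_psi : R -> R;
  cdv_phiL : nat -> R -> R;
  cdv_phiR : nat -> R -> R;
  cdv_psiL : nat -> R -> R;
  cdv_psiR : nat -> R -> R
}.

Definition cdv_scaling (B : cdv_data) : nat -> nat -> R -> R :=
  cdv_fun (cdv_M B) (cdv_phi B) (cdv_phiL B) (cdv_phiR B).

Definition cdv_detail (B : cdv_data) : nat -> nat -> R -> R :=
  cdv_fun (cdv_M B) (cdv_psi B) (cdv_psiL B) (cdv_psiR B).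

(* Level l0 holds the 2^(l0+1) father wavelets at scale 2^(l0+1), so that the
   levels l0, ..., l together span the scaling space of dimension 2^(l+1). The
   values outside [0, 1] are irrelevant. *)
Definition wav (B : cdv_data) (l k : nat) : R -> R :=
  if l == cdv_l0 B then cdv_scaling B (cdv_l0 B).+1 k else cdv_detail B l k.

Definition wav_size (B : cdv_data) (l : nat) : nat :=
  (if l == cdv_l0 B then 2 ^ (cdv_l0 B).+1 else 2 ^ l)%N.

Definition wav_coef (B : cdv_data) (f : R -> R) (l k : nat) : R :=
  inner01 f (wav B l k).

(* A-regularity is the conjunction of the smoothness fields ([cdv_phi] is of
   class C^A) and of [cdv_A_le_M]. *)
Record cdv_basis (B : cdv_data) : Prop := {
  cdv_A_le_M : (cdv_A B <= cdv_M B)%N;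
  cdv_phi_derivable : forall r, (r < cdv_A B)%N -> forall x : R,
    derivable (derive1n r (cdv_phi B)) x 1;
  cdv_phi_continuous : continuous (derive1n (cdv_A B) (cdv_phi B));
  cdv_phi_supp : forall x : R, x < 1 - (cdv_M B)%:R \/ (cdv_M B)%:R < x ->
    cdv_phi B x = 0;
  cdv_phi_integral : \int[mu]_x cdv_phi B x = 1;
  cdv_phi_orthonormal : forall k : int,
    \int[mu]_x (cdv_phi B x * cdv_phi B (x - k%:~R)) = (k == 0)%:R;
  cdv_phi_refinement : forall x, cdv_phi B x =
    Num.sqrt 2 * \sum_(n < 2 * cdv_M B)
      cdv_h B n * cdv_phi B (2 * x - (n%:R - (cdv_M B)%:R + 1));
  cdv_psi_refinement : forall x, cdv_psi B x =
    Num.sqrt 2 * \sum_(n < 2 * cdv_M B)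
      (-1) ^+ n * cdv_h B (2 * cdv_M B - 1 - n)%N
        * cdv_phi B (2 * x - (n%:R - (cdv_M B)%:R + 1));
  cdv_psi_moments : forall r, (r < cdv_M B)%N ->
    \int[mu]_x (x ^+ r * cdv_psi B x) = 0;
  cdv_coarse : (2 * cdv_M B <= 2 ^ (cdv_l0 B).+1)%N;
  cdv_phiL_edge : edge_scaling (cdv_M B) (cdv_phi B) (cdv_phiL B);
  cdv_phiR_edge : edge_scaling (cdv_M B) (reflected (cdv_phi B)) (cdv_phiR B);
  cdv_psiL_supp : forall k, (k < cdv_M B)%N -> forall y : R,
    (2 * cdv_M B)%:R - 1 < y -> cdv_psiL B k y = 0;
  cdv_psiR_supp : forall k, (k < cdv_M B)%N -> forall y : R,
    (2 * cdv_M B)%:R - 1 < y -> cdv_psiR B k y = 0;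
  cdv_scaling_orthonormal : forall j k k', (cdv_l0 B < j)%N ->
    (k < 2 ^ j)%N -> (k' < 2 ^ j)%N ->
    inner01 (cdv_scaling B j k) (cdv_scaling B j k') = (k == k')%:R;
  cdv_scaling_nested : forall j k, (cdv_l0 B < j)%N -> (k < 2 ^ j)%N ->
    in_span01 (2 ^ j.+1) (cdv_scaling B j.+1) (cdv_scaling B j k);
  cdv_detail_nested : forall j k, (cdv_l0 B < j)%N -> (k < 2 ^ j)%N ->
    in_span01 (2 ^ j.+1) (cdv_scaling B j.+1) (cdv_detail B j k);
  wav_orthonormal : forall l l' k k',
    (cdv_l0 B <= l)%N -> (cdv_l0 B <= l')%N ->
    (k < wav_size B l)%N -> (k' < wav_size B l')%N ->
    inner01 (wav B l k) (wav B l' k') = ((l == l') && (k == k'))%:R;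
  wav_complete : forall f : R -> R, measurable_fun (`[0, 1] : set R) f ->
    mu.-integrable `[0, 1] (fun x : R => (f x ^+ 2)%:E) ->
    (fun L : nat => \int[mu]_(x in `[0, 1])
       (f x - \sum_(cdv_l0 B <= l < L) \sum_(k < wav_size B l)
                wav_coef B f l k * wav B l k x) ^+ 2) @ \oo --> (0 : R)
}.

Definition wav_support (B : cdv_data) (l k : nat) : set R :=
  closure [set x | 0 <= x <= 1 /\ wav B l k x != 0].

Definition overlap_bound (B : cdv_data) (cA : nat) : Prop :=
  forall l (x : R), (cdv_l0 B <= l)%N -> 0 <= x <= 1 ->
    (#|[set k : 'I_(wav_size B l) | `[< wav_support B l k x >]]|
       <= cA)%N.

(* exponents range over [1, +oo]; [fine +oo = 0], so that 1/+oo = 0 here *)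
Definition inv_exponent (p : \bar R) : R := (fine p)^-1.

Definition lp_norm (p : \bar R) (s : nat) (v : nat -> R) : R :=
  if p is r%:E then (\sum_(k < s) `|v k| `^ r) `^ r^-1
  else \big[Num.max/0]_(k < s) `|v k|.

Definition besov_term (B : cdv_data) (alpha : R) (p : \bar R) (f : R -> R)
    (l : nat) : R :=
  2 `^ (l%:R * (alpha + 2^-1 - inv_exponent p))
    * lp_norm p (wav_size B l) (wav_coef B f l).

Definition besov_norm (B : cdv_data) (alpha : R) (p q : \bar R)
    (f : R -> R) : \bar R :=
  if q is r%:E then
    ((\sum_(cdv_l0 B <= l <oo) (besov_term B alpha p f l `^ r)%:E) `^ r^-1)%E
  else ereal_sup [set (besov_term B alpha p f l)%:E
                 | l in [set l | (cdv_l0 B <= l)%N]].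

(* For alpha > 1/p every L2 class of finite Besov norm has a unique continuous
   representative; f(x0) is the value of that representative. *)
Definition besov_ball (B : cdv_data) (alpha : R) (p q : \bar R) (r : R) :
    set (R -> R) :=
  [set f : R -> R | {within `[0, 1], continuous f} /\
           (besov_norm B alpha p q f <= r%:E)%E].

End Wavelets.

Arguments cdv_data : clear implicits.

Section Protocol.
Context {R : realType}.
Local Notation mu := (@lebesgue_measure R).

Definition clip (tau x : R) : R := Num.max (- tau) (Num.min x tau).

(* an observation is a pair (Y, X) *)
Definition local_coef (B : cdv_data R) (tau : R) (s : nat) (z : 'I_s -> R * R)
    (l k : nat) : R :=
  s%:R^-1 * \sum_(i < s) clip tau (z i).1 * wav B l k (z i).2.

Definition local_estimate (B : cdv_data R) (tau : R) (L s : nat)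
    (z : 'I_s -> R * R) (x0 : R) : R :=
  \sum_(cdv_l0 B <= l < L.+1) \sum_(k < wav_size B l)
    local_coef B tau z l k * wav B l k x0.

Definition noise_scale (B : cdv_data R) (cA : nat) (tau : R) (L s : nat)
    (eps : R) : R :=
  2 * cA%:R * sup_norm (cdv_psi B) ^+ 2 * tau * 2 ^+ L / (s%:R * eps).

Definition transcript (B : cdv_data R) (tau : R) (L s : nat)
    (z : 'I_s -> R * R) (x0 w : R) : R :=
  local_estimate B tau L z x0 + w.

Definition raw_weight (L s : nat) (eps : R) : R :=
  Num.min (s%:R ^+ 2 * eps ^+ 2) (s%:R * 2 ^+ L).

Definition weight (L m : nat) (n : 'I_m -> nat) (eps : 'I_m -> R) (j : 'I_m) :
    R :=
  raw_weight L (n j) (eps j) / \sum_(i < m) raw_weight L (n i) (eps i).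

Definition estimator (m : nat) (n : 'I_m -> nat) (eps : 'I_m -> R) (L : nat)
    (T : 'I_m -> R) : R :=
  \sum_(j < m) weight L n eps j * T j.

Definition laplace_pdf (m b x : R) : R := (2 * b)^-1 * expR (- (`|x - m| / b)).

Definition laplace_prob (m b : R) (U : set R) : \bar R :=
  (\int[mu]_(x in U) (laplace_pdf m b x)%:E)%E.

Definition has_law d (Omega : measurableType d) (P : probability Omega R)
    (V : Omega -> R) (law : set R -> \bar R) : Prop :=
  forall U : set R, measurable U -> P (V @^-1` U) = law U.

(* The product rule for every finite subfamily is recovered by taking the
   remaining [U i] to be [setT]. *)
Definition mutually_independent d (Omega : measurableType d)
    (P : probability Omega R) (I : finType) (V : I -> Omega -> R) : Prop :=
  forall U : I -> set R, (forall i, measurable (U i)) ->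
    P [set w | forall i, U i (V i w)] = (\prod_i P (V i @^-1` U i))%E.

Definition primitives (m : nat) (n : 'I_m -> nat) (Omega : Type)
    (X xi : forall j, 'I_(n j) -> Omega -> R) (W : 'I_m -> Omega -> R)
    (i : {j : 'I_m & 'I_(n j)} + {j : 'I_m & 'I_(n j)} + 'I_m) : Omega -> R :=
  match i with
  | inl (inl (existT j i)) => X j i
  | inl (inr (existT j i)) => xi j i
  | inr j => W j
  end.

(* Design points, regression errors and privacy noises, none of whose laws
   depend on f; [observation] then has the law P_f, independently across
   (j, i) and independently of the noises. *)
Definition sampling_model d (Omega : measurableType d)
    (P : probability Omega R) (m : nat) (n : 'I_m -> nat) (b : 'I_m -> R)
    (X xi : forall j, 'I_(n j) -> {RV P >-> R}) (W : 'I_m -> {RV P >-> R}) :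
    Prop :=
  [/\ forall j i w, 0 <= X j i w <= 1,
      forall j i, has_law P (X j i) (uniform_prob (@ltr01 R)),
      forall j i, has_law P (xi j i) (normal_prob 0 1),
      forall j, has_law P (W j) (laplace_prob 0 (b j)) &
      mutually_independent P
        (primitives (fun j i => X j i : Omega -> R)
                    (fun j i => xi j i : Omega -> R)
                    (fun j => W j : Omega -> R))].

Definition observation (f : R -> R) (m : nat) (n : 'I_m -> nat) (Omega : Type)
    (X xi : forall j, 'I_(n j) -> Omega -> R) (w : Omega) (j : 'I_m)
    (i : 'I_(n j)) : R * R :=
  (f (X j i w) + xi j i w, X j i w).

Definition pointwise_error d (Omega : measurableType d)
    (P : probability Omega R) (B : cdv_data R) (m : nat) (n : 'I_m -> nat)
    (eps : 'I_m -> R) (L : nat) (tau : R)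
    (X xi : forall j, 'I_(n j) -> {RV P >-> R}) (W : 'I_m -> {RV P >-> R})
    (x0 : R) (f : R -> R) (w : Omega) : R :=
  let Z := observation f (fun j i => X j i : Omega -> R)
                         (fun j i => xi j i : Omega -> R) w in
  estimator n eps L (fun j => transcript B tau L (Z j) x0 (W j w)) - f x0.

Definition pointwise_risk d (Omega : measurableType d)
    (P : probability Omega R) (B : cdv_data R) (m : nat) (n : 'I_m -> nat)
    (eps : 'I_m -> R) (L : nat) (tau : R)
    (X xi : forall j, 'I_(n j) -> {RV P >-> R}) (W : 'I_m -> {RV P >-> R})
    (x0 : R) (f : R -> R) : \bar R :=
  ('E_P [fun w : Omega => (pointwise_error B eps L tau X xi W x0 f w ^+ 2)%R])%E.

End Protocol.

(* Main.v *)
(* The risk at [x0] splits into squared bias and variance. For the variance, the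
   local estimates are sample means of [clip tau Y * K (X, x0)], where the
   wavelet kernel [K] has squared L2 norm of order 2^L, so the [j]-th transcript
   has variance of order [tau^2 2^(2L) / v_j]; with weights proportional to
   [v_j] the total is [tau^2 2^(2L) / sum_j v_j], and the equation for [D]
   turns this into [tau^2 2^(-2 L nu)]. For the bias, the threshold exceeds
   [|f|] by [t = sqrt (2 (2 nu + 1) L)], so clipping costs only
   [e^(- t^2 / 4) 2^(L / 2) <= 2^(- L nu)], and the truncated wavelet
   expansion converges to [f] at [x0] at the rate [2^(- L nu)]. Constants
   depending on the class are absorbed by [ln N]; the factor in front of [ln N]
   involves only the basis, because [(2 nu + 1) L <= const + 2 ln N] and
   [nu < A]. *)

Require Import Defs.
From HB Require Import structures.
From mathcomp Require Import all_boot all_order all_algebra.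
From mathcomp Require Import all_classical all_reals all_analysis.
From mathcomp Require Import measurable_realfun ring lra zify.

Set Implicit Arguments.
Unset Strict Implicit.
Unset Printing Implicit Defensive.

Import Order.TTheory GRing.Theory Num.Theory.
Import numFieldNormedType.Exports.

Local Open Scope classical_set_scope.
Local Open Scope ring_scope.

(** * Random variables with a density *)

(** The factor in front of [ln N] must not see the class, although the class sits in [tau], in the
    exponent 2 nu + 2 and in the bias. In [tau] it cancels: dropping the privacy arm of every
    minimum in the equation for [D] leaves D^(2 nu + 1) <= N, so (2 nu + 1) log2 D is at most a
    numerical multiple of [ln N]. What the exponent costs is the overshoot 2^L / D raised to 2 nu +
    2. It is at most 2^(2 nu + 2) when L comes from rounding log2 D up; when L is held at its floor
    l0 + 1, the lower bound on [D] controls it, and L is then fixed, so that no logarithm appears.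

    A second obstacle is that the basis is given by qualitative axioms: the boundary wavelets have
    no formula, and completeness holds in L2 only. The size of the boundary wavelets comes from
    continuity at the coarsest scale, since finer scales dilate the same functions; pointwise
    convergence needs the continuity of f together with the geometric decay of the levels. *)

Section Density.
Context d (T : measurableType d) (R : realType).
Variables (mu nu : {measure set T -> \bar R}) (p : T -> R).
Hypotheses (mp : measurable_fun setT p) (p0 : forall x, 0 <= p x).
Hypothesis nuE : forall U, measurable U -> nu U = (\int[mu]_(x in U) (p x)%:E)%E.
Local Open Scope ereal_scope.

Import HBNNSimple.

Let mulp0 (g : {nnsfun T >-> R}) x : 0 <= (g x)%:E * (p x)%:E.
Proof. by rewrite -EFinM lee_fin mulr_ge0. Qed.

Let density_nnsfun (g : {nnsfun T >-> R}) :
  \int[nu]_x (g x)%:E = \int[mu]_x ((g x)%:E * (p x)%:E).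
Proof.
under eq_integral do rewrite fimfunE -fsumEFin//.
rewrite ge0_integral_fsum//; last 2 first.
- by move=> r; exact/measurable_EFinP/measurableT_comp.
- by move=> r x _; rewrite EFinM nnfun_muleindic_ge0.
under [RHS]eq_integral.
  move=> x _; rewrite fimfunE -fsumEFin// ge0_mule_fsuml; last first.
    by move=> r; rewrite EFinM nnfun_muleindic_ge0.
  over.
rewrite ge0_integral_fsum//; last 2 first.
- move=> r; apply: emeasurable_funM; last exact/measurable_EFinP.
  by apply/measurable_EFinP/measurableT_comp.
- by move=> r x _; rewrite mule_ge0 ?(lee_fin _ (p _))// EFinM nnfun_muleindic_ge0.
apply: eq_fsbigr => r /[!inE] -[x _ <-].
have mr : measurable (g @^-1` [set g x]) by [].
under eq_integral do rewrite EFinM.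
rewrite ge0_integralZl//; last 2 first.
- exact/measurable_EFinP.
- by rewrite lee_fin.
rewrite integral_indic// setIT nuE// integral_mkcond/=.
under [RHS]eq_integral do rewrite EFinM -muleA.
rewrite ge0_integralZl//; last 3 first.
- by apply: emeasurable_funM; apply/measurable_EFinP.
- by move=> y _; rewrite -EFinM lee_fin mulr_ge0.
- by rewrite lee_fin.
congr (_ * _); apply: eq_integral => y _; rewrite patchE /= indicE.
by case: ifPn => _; rewrite ?mul1e ?mul0e.
Qed.

(** Simple functions see only the values of [nu] on measurable sets, which [nuE] gives; monotone
    convergence along [nnsfun_approx] does the rest. *)
Lemma ge0_integral_density (g : T -> \bar R) : measurable_fun setT g ->
  (forall x, 0 <= g x) -> \int[nu]_x g x = \int[mu]_x (g x * (p x)%:E).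
Proof.
move=> mg g0; pose g_ := nnsfun_approx measurableT mg.
transitivity (lim ((\int[nu]_x (g_ n x)%:E) @[n --> \oo])).
  rewrite -monotone_convergence//=.
  - by apply: eq_integral => ? _; apply/esym/cvg_lim => //; exact: cvg_nnsfun_approx.
  - by move=> n; exact/measurable_EFinP/measurable_funTS.
  - by move=> n ? _; rewrite lee_fin.
  - by move=> ? _ ? ? mn; rewrite lee_fin; exact/lefP/nd_nnsfun_approx.
transitivity (lim ((\int[mu]_x ((g_ n x)%:E * (p x)%:E)) @[n --> \oo])).
  by apply: congr_lim; apply/funext => n; exact: density_nnsfun.
rewrite -monotone_convergence//=.
- apply: eq_integral => x _; apply/cvg_lim => //.
  apply: cvgeZr => //.
  by apply: cvg_nnsfun_approx.
- move=> n; apply: emeasurable_funM; last exact/measurable_EFinP.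
  exact/measurable_EFinP/measurable_funTS.
- move=> x _ m n mn; rewrite lee_wpmul2r ?lee_fin//.
  exact/lefP/nd_nnsfun_approx.
Qed.

End Density.

Section Law.
Context d (Omega : measurableType d) (R : realType) (P : probability Omega R).
Local Notation mu := (@lebesgue_measure R).
Variables (V : {RV P >-> R}) (p : R -> R).
Hypotheses (mp : measurable_fun setT p) (p0 : forall x, 0 <= p x).
Hypothesis Vp : has_law P V (fun U => (\int[mu]_(x in U) (p x)%:E)%E).

Lemma ge0_integral_law (g : R -> \bar R) : measurable_fun setT g ->
  (forall x, (0 <= g x)%E) ->
  (\int[P]_w g (V w) = \int[mu]_x (g x * (p x)%:E))%E.
Proof.
(* [V'] is [V] with values retyped in [measurableTypeR R], so that its distribution can be compared
   with Lebesgue measure. *)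
move=> mg g0; pose V' := V : Omega -> measurableTypeR R.
have mV : measurable_fun [set: Omega] V' by exact: (measurable_funP V).
pose mixin := isMeasurableFun.Build _ _ _ _ V' mV.
pose VR : {mfun Omega >-> measurableTypeR R} := HB.pack V' mixin.
pose nu : {measure set (measurableTypeR R) -> \bar R} := distribution P VR.
rewrite -(@ge0_integral_density _ _ R mu nu p mp p0 _ g mg g0); last first.
  by move=> U mU; rewrite -Vp.
by rewrite -(ge0_integral_distribution VR mg g0).
Qed.

(** No integrability is asked: a nonnegative density passes through the maximum with 0, so positive
    and negative parts transform separately. *)
Lemma integral_law (g : R -> \bar R) : measurable_fun setT g ->
  (\int[P]_w g (V w) = \int[mu]_x (g x * (p x)%:E))%E.
Proof.
move=> mg; rewrite integralE [RHS]integralE; congr (_ - _)%E.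
- rewrite -[fun w => g (V w)]/(g \o V) funepos_comp ge0_integral_law//; last first.
    exact: measurable_funepos.
  apply: eq_integral => x _.
  by rewrite !funeposE maxe_pMl ?lee_fin// mul0e.
- rewrite -[fun w => g (V w)]/(g \o V) funeneg_comp ge0_integral_law//; last first.
    exact: measurable_funeneg.
  apply: eq_integral => x _.
  by rewrite !funenegE maxe_pMl ?lee_fin// mul0e mulNe.
Qed.

End Law.

(** * Symmetric densities, and the moments of the uniform, normal and Laplace laws *)

Section EvenLaw.
Context (R : realType).
Local Notation mu := (@lebesgue_measure R).

Lemma ge0_integral_oppT (g : R -> \bar R) : measurable_fun setT g ->
  (forall x, (0 <= g x)%E) -> (\int[mu]_x g (- x)%R = \int[mu]_x g x)%E.
Proof.
move=> mg g0.
rewrite -[fun x => g (- x)]/(g \o (-%R : measurableTypeR R -> measurableTypeR R)).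
rewrite -[X in (\int[mu]_(x in X) _)%E](preimage_setT
  (-%R : measurableTypeR R -> measurableTypeR R)).
rewrite -ge0_integral_pushforward//.
by apply: eq_measure_integral => A mA _; exact: lebesgue_measureN.
Qed.

Context d (Omega : measurableType d) (P : probability Omega R).

(** Reflection turns the negative part into the positive one, so both have the same integral;
    integrability makes it finite, so the difference is 0. *)
Lemma mean_even_law (V : {RV P >-> R}) (p : R -> R) :
  measurable_fun setT p -> (forall x, 0 <= p x) -> (forall x, p (- x) = p x) ->
  has_law P V (fun U => (\int[mu]_(x in U) (p x)%:E)%E) ->
  P.-integrable setT (EFin \o V) -> \int[P]_w V w = 0.
Proof.
move=> mp p0 pe Vp iV; rewrite /Rintegral.
have iVp := integrable_funepos measurableT iV.
have -> : (\int[P]_w (V w)%:E = \int[P]_w (EFin \o V)^\+ w - \int[P]_w (EFin \o V)^\- w)%E.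
  by rewrite integralE.
have -> : (\int[P]_w (EFin \o V)^\- w = \int[P]_w (EFin \o V)^\+ w)%E.
  rewrite funeneg_comp funepos_comp.
  have mE : measurable_fun [set: R] (@EFin R) by [].
  have mEn : measurable_fun [set: R] (EFin^\-%E : R -> \bar R).
    exact: measurable_funeneg.
  have mEp : measurable_fun [set: R] (EFin^\+%E : R -> \bar R).
    exact: measurable_funepos.
  rewrite (ge0_integral_law mp p0 Vp mEn)// (ge0_integral_law mp p0 Vp mEp)//.
  rewrite -ge0_integral_oppT//; last first.
  - by move=> x; rewrite mule_ge0// lee_fin.
  - by apply: emeasurable_funM => //; exact/measurable_EFinP.
  apply: eq_integral => x _; rewrite pe; congr (_ * _)%E.
  by rewrite funenegE funeposE /= opprK.
by rewrite subee// integrable_fin_num.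
Qed.

End EvenLaw.

Section UniformLaw.
Context (R : realType) d (Omega : measurableType d) (P : probability Omega R).
Local Notation mu := (@lebesgue_measure R).
Variables (X : {RV P >-> R}).
Hypothesis XU : has_law P X (uniform_prob (@ltr01 R)).

Lemma integral_uniform_law (g : R -> \bar R) : measurable_fun setT g ->
  (\int[P]_w g (X w) = \int[mu]_(x in `[0%R, 1%R]) g x)%E.
Proof.
move=> mg; rewrite (integral_law (measurable_uniform_pdf 0 1) _ XU mg); last first.
  by move=> x; exact: uniform_pdf_ge0.
rewrite [RHS]integral_mkcond; apply: eq_integral => x _; rewrite patchE /uniform_pdf.
rewrite mem_setE in_itv/=; case: ifP => _; last by rewrite mule0.
by rewrite subr0 invr1 mule1.
Qed.

End UniformLaw.

Section NormalLaw.
Context (R : realType) d (Omega : measurableType d) (P : probability Omega R).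
Local Notation mu := (@lebesgue_measure R).
Variables (xi : {RV P >-> R}).
Hypothesis xiN : has_law P xi (normal_prob 0 1).

(** Since 3/8 - 1/2 = -1/8, the product with the standard density is twice the density of standard
    deviation 2. The exponent 3/8 is 1/4 + 1/8: in [excess_le_exp], 1/4 yields the tail factor and
    1/8 absorbs the linear factor. *)
Lemma normal_exp_sqr : (\int[P]_w (expR (3 / 8 * xi w ^+ 2))%:E = 2%:E)%E.
Proof.
have m1 := measurable_normal_pdf (0 : R) 1.
have m2 : measurable_fun [set: R] (fun x : R => (expR (3 / 8 * x ^+ 2))%:E).
  apply/measurable_EFinP/measurableT_comp => //.
  by apply: measurable_funM => //; exact: measurable_funX.
rewrite (ge0_integral_law m1 _ xiN m2); last 2 first.
- by move=> x; exact: normal_pdf_ge0.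
- by move=> x; rewrite lee_fin expR_ge0.
transitivity (\int[mu]_x (2%:E * (normal_pdf 0 2 x)%:E))%E.
  apply: eq_integral => x _; rewrite -!EFinM; congr (_%:E).
  rewrite !normal_pdfE ?oner_eq0 ?pnatr_eq0// /normal_fun !subr0.
  rewrite mulrCA -expRD.
  have -> : 3 / 8 * x ^+ 2 + - x ^+ 2 / (1 ^+ 2 *+ 2) = - x ^+ 2 / (2 ^+ 2 *+ 2).
    by rewrite expr1n !mulr2n; field.
  rewrite mulrA; congr (_ * _).
  rewrite /normal_peak -[in RHS]mulrnAr sqrtrM ?sqr_ge0// sqrtr_sqr ger0_norm//.
  rewrite invfM mulrA divff ?pnatr_eq0// mul1r expr1n mul1r.
  by [].
rewrite ge0_integralZl//.
- by rewrite integral_normal_pdf mule1.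
- by apply/measurable_EFinP; exact: measurable_normal_pdf.
- by move=> x _; rewrite lee_fin normal_pdf_ge0.
Qed.

Lemma integrable_normal_exp_sqr :
  P.-integrable setT (EFin \o (fun w => expR (3 / 8 * xi w ^+ 2))).
Proof.
apply/integrableP; split.
  apply/measurable_EFinP/measurableT_comp => //.
  by apply: measurable_funM => //; exact: measurable_funX.
under eq_integral do rewrite /= ger0_norm ?expR_ge0//.
by rewrite normal_exp_sqr ltry.
Qed.

Lemma normal_integrable_sqr : P.-integrable setT (EFin \o (fun w => xi w ^+ 2)).
Proof.
apply: (le_integrable measurableT _ _
  (integrableZl measurableT 3 integrable_normal_exp_sqr)).
  exact/measurable_EFinP/measurable_funX.
move=> w _ /=; rewrite lee_fin ger0_norm ?sqr_ge0//.
rewrite ger0_norm ?mulr_ge0 ?expR_ge0//.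
have := expR_ge1Dx (3 / 8 * xi w ^+ 2); have := sqr_ge0 (xi w); lra.
Qed.

Lemma normal_integrable : P.-integrable setT (EFin \o xi).
Proof.
have i1 : P.-integrable setT (EFin \o cst (1:R)).
  exact: finite_measure_integrable_cst.
apply: (le_integrable measurableT _ _ (integrableD measurableT i1 normal_integrable_sqr)).
  exact/measurable_EFinP.
move=> w _ /=; rewrite lee_fin [leRHS]ger0_norm; last first.
  by rewrite addr_ge0// sqr_ge0.
rewrite -real_normK ?num_real//; have := sqr_ge0 (`|xi w| - 1).
rewrite sqrrB1; have := normr_ge0 (xi w); lra.
Qed.

Lemma normal_mean0 : \int[P]_w xi w = 0.
Proof.
apply: (mean_even_law _ _ _ xiN) normal_integrable.
- exact: measurable_normal_pdf.
- by move=> x; exact: normal_pdf_ge0.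
- by move=> x; rewrite !normal_pdfE ?oner_eq0// /normal_fun !subr0 sqrrN.
Qed.

(* [(|x| - t)^+ <= |x| e^{(x^2 - t^2) / 4}] and [|x| <= 2 e^{x^2 / 8}] *)
Lemma excess_le_exp (x t : R) : 0 <= t ->
  Num.max (`|x| - t) 0 <= 2 * expR (- (t ^+ 2 / 4)) * expR (3 / 8 * x ^+ 2).
Proof.
move=> t0; rewrite -mulrA -expRD ge_max mulr_ge0 ?expR_ge0// andbT.
have [xt|xt] := leP `|x| t.
  by apply: (@le_trans _ _ 0); [rewrite subr_le0|rewrite mulr_ge0 ?expR_ge0].
have -> : - (t ^+ 2 / 4) + 3 / 8 * x ^+ 2 = x ^+ 2 / 8 + (x ^+ 2 - t ^+ 2) / 4.
  by field.
rewrite expRD mulrA -[leLHS]mulr1; apply: ler_pM => //.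
- by rewrite subr_ge0 ltW.
- have := expR_ge1Dx (x ^+ 2 / 8); rewrite -real_normK ?num_real//.
  have := sqr_ge0 (`|x| - 2); rewrite sqrrB mulr2n; lra.
- apply: (le_trans _ (expR_ge1Dx _)); rewrite lerDl divr_ge0// subr_ge0.
  by rewrite -[leRHS]real_normK ?num_real// ler_pXn2r// ?nnegrE// ltW.
Qed.

(** The constant 4 is the 2 of [excess_le_exp] times the mean 2 of [normal_exp_sqr]. Half the
    Gaussian rate suffices, as the theorem takes t^2 / 4 = L (nu + 1/2). *)
Lemma normal_excess (t : R) : 0 <= t ->
  P.-integrable setT (EFin \o (fun w => Num.max (`|xi w| - t) 0)) /\
  \int[P]_w Num.max (`|xi w| - t) 0 <= 4 * expR (- (t ^+ 2 / 4)).
Proof.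
move=> t0; have i2 := integrableZl measurableT
  (2 * expR (- (t ^+ 2 / 4))) integrable_normal_exp_sqr.
have i1 : P.-integrable setT (EFin \o (fun w => Num.max (`|xi w| - t) 0)).
  apply: (le_integrable measurableT _ _ i2).
    apply/measurable_EFinP/measurable_maxr => //.
    by apply: measurable_funB => //; exact: measurableT_comp.
  move=> w _ /=; rewrite lee_fin [leLHS]ger0_norm ?le_max ?lexx ?orbT//.
  by rewrite [leRHS]ger0_norm ?mulr_ge0 ?expR_ge0// excess_le_exp.
split=> //; apply: (@le_trans _ _ (\int[P]_w
    (2 * expR (- (t ^+ 2 / 4)) * expR (3 / 8 * xi w ^+ 2)))).
  by apply: le_Rintegral => // w _; exact: excess_le_exp.
rewrite RintegralZl//; last exact: integrable_normal_exp_sqr.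
by rewrite /Rintegral normal_exp_sqr/= le_eqVlt; apply/orP; left; apply/eqP; ring.
Qed.

End NormalLaw.

Section LaplaceLaw.
Context (R : realType) d (Omega : measurableType d) (P : probability Omega R).
Local Notation mu := (@lebesgue_measure R).
Variables (W : {RV P >-> R}) (b : R).
Hypotheses (b0 : 0 <= b) (WL : has_law P W (laplace_prob 0 b)).

Lemma laplace_pdf_ge0 x : 0 <= laplace_pdf 0 b x.
Proof. by rewrite mulr_ge0 ?expR_ge0// invr_ge0 mulr_ge0. Qed.

Lemma measurable_laplace_pdf : measurable_fun setT (laplace_pdf 0 b).
Proof.
apply: measurable_funM => //; apply: measurableT_comp => //.
apply: measurableT_comp => //; apply: measurable_funM => //.
by apply: measurableT_comp => //; exact: measurable_funB.
Qed.

Let integral_two_sided_exp (r : R) : 0 < r ->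
  (\int[mu]_x (expR (- (r * `|x|)))%:E = (2 / r)%:E)%E.
Proof.
move=> r0; rewrite ge0_symfun_integralT; last 3 first.
- by move=> x; exact: expR_ge0.
- move=> x; apply: continuous_comp; last exact: continuous_expR.
  apply: continuousN; apply: continuousM; first exact: cst_continuous.
  exact: norm_continuous.
- by move=> x /=; rewrite normrN.
rewrite (EFinM 2); congr (_ * _)%E.
have := integral_exponential_pdf r0; rewrite -set_itvcy.
rewrite (_ : (fun x => (exponential_pdf r x)%:E) =
    (fun x => (r * expR (- (r * `|x|)))%:E) \_ `[0%R, +oo[).
  rewrite -integral_mkcond => h.
  rewrite -[X in (_ = X)%E]mule1 -h -ge0_integralZl//.
  - by apply: eq_integral => x _; rewrite -EFinM mulrA mulVf ?mul1r ?gt_eqF.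
  - apply/measurable_EFinP/measurable_funTS/measurable_funM => //.
    apply: measurableT_comp => //; apply: measurableT_comp => //.
    by apply: measurable_funM => //; exact: measurableT_comp.
  - by move=> x _; rewrite lee_fin mulr_ge0 ?expR_ge0// ltW.
  - by rewrite lee_fin invr_ge0 ltW.
apply/funext => x; rewrite /exponential_pdf !patchE; case: ifPn => //.
by rewrite inE/= in_itv/= andbT => x0; rewrite ger0_norm// mulNr.
Qed.

(** With y = |x| / (2 b) the density decays like e^(-2 y): one factor e^(-y) absorbs y^2, because
    y^2 e^(-y) <= 2, and the other integrates to 4 b. *)
Lemma laplace_sqr_le : (\int[P]_w (W w ^+ 2)%:E <= (16 * b ^+ 2)%:E)%E.
Proof.
have m2 : measurable_fun [set: R] (fun x : R => (x ^+ 2)%:E).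
  exact/measurable_EFinP/measurable_funX.
rewrite (ge0_integral_law measurable_laplace_pdf laplace_pdf_ge0 WL m2); last first.
  by move=> x; rewrite lee_fin sqr_ge0.
(* At scale 0 the convention [0^-1 = 0] makes the density, hence the integral, vanish. *)
have [->|bn0] := eqVneq b 0.
  rewrite expr0n/= mulr0 integral0_eq// => x _.
  by rewrite /laplace_pdf mulr0 invr0 mul0r mule0.
have bp : 0 < b by rewrite lt_neqAle eq_sym bn0.
have r0 : 0 < (2 * b)^-1 by rewrite invr_gt0 mulr_gt0.
apply: (@le_trans _ _ (\int[mu]_x ((4 * b)%:E * (expR (- ((2 * b)^-1 * `|x|)))%:E))%E).
  apply: ge0_le_integral => //.
  - by move=> x _; rewrite -EFinM lee_fin mulr_ge0 ?sqr_ge0 ?laplace_pdf_ge0.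
  - apply: emeasurable_funM => //.
    by apply/measurable_EFinP; exact: measurable_laplace_pdf.
  - apply/measurable_EFinP/measurable_funM => //.
    apply: measurableT_comp => //; apply: measurableT_comp => //.
    by apply: measurable_funM => //; exact: measurableT_comp.
  - move=> x _; rewrite -!EFinM lee_fin /laplace_pdf subr0.
    set y := (2 * b)^-1 * `|x|.
    have y0 : 0 <= y by rewrite mulr_ge0// ltW.
    have xE : `|x| = 2 * b * y by rewrite /y mulrA divff ?mul1r ?gt_eqF// mulr_gt0.
    rewrite -[x ^+ 2]real_normK ?num_real// xE.
    have -> : 2 * b * y / b = y + y by field.
    rewrite opprD expRD.
    have -> : (2 * b * y) ^+ 2 * ((2 * b)^-1 * (expR (- y) * expR (- y))) =
        (2 * b) * (y ^+ 2 * expR (- y)) * expR (- y) by field.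
    rewrite ler_wpM2r ?expR_ge0//.
    have yexp : y ^+ 2 * expR (- y) <= 2.
      rewrite expRN ler_pdivrMr ?expR_gt0//.
      by have := expR_ge1Dxn 1 y0; rewrite -[2`!%N]/2%N; lra.
    apply: (le_trans (ler_wpM2l _ yexp)); first by rewrite mulr_ge0.
    by rewrite mulrAC -natrM.
rewrite ge0_integralZl//; last 2 first.
- apply/measurable_EFinP.
  apply: measurableT_comp => //; apply: measurableT_comp => //.
  by apply: measurable_funM => //; exact: measurableT_comp.
- by rewrite lee_fin mulr_ge0.
rewrite integral_two_sided_exp// -EFinM lee_fin invrK le_eqVlt; apply/orP; left.
by apply/eqP; ring.
Qed.

Lemma laplace_integrable_sqr : P.-integrable setT (EFin \o (fun w => W w ^+ 2)).
Proof.
apply/integrableP; split.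
  exact/measurable_EFinP/measurable_funX.
under eq_integral do rewrite /= ger0_norm ?sqr_ge0//.
by apply: (le_lt_trans laplace_sqr_le); rewrite ltry.
Qed.

Lemma laplace_mean0 : \int[P]_w W w = 0.
Proof.
apply: (mean_even_law measurable_laplace_pdf laplace_pdf_ge0 _ WL).
  by move=> x; rewrite /laplace_pdf !subr0 normrN.
have i1 : P.-integrable setT (EFin \o cst (1:R)).
  exact: finite_measure_integrable_cst.
apply: (le_integrable measurableT _ _ (integrableD measurableT i1 laplace_integrable_sqr)).
  exact/measurable_EFinP.
move=> w _ /=; rewrite lee_fin [leRHS]ger0_norm; last first.
  by rewrite addr_ge0// sqr_ge0.
rewrite -real_normK ?num_real//; have := sqr_ge0 (`|W w| - 1).
rewrite sqrrB1; have := normr_ge0 (W w); lra.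
Qed.

End LaplaceLaw.

(** * Independence *)

Section RintegralSum.
Context d (T : measurableType d) (R : realType) (mu : {measure set T -> \bar R}).

Lemma Rintegral_sum (I : eqType) (s : seq I) (D : set T) (V : I -> T -> R) :
  measurable D -> (forall i, i \in s -> mu.-integrable D (EFin \o V i)) ->
  mu.-integrable D (EFin \o (fun w => \sum_(i <- s) V i w)) /\
  \int[mu]_(w in D) (\sum_(i <- s) V i w) = \sum_(i <- s) \int[mu]_(w in D) V i w.
Proof.
move=> mD; elim: s => [_|i s ih iV].
  rewrite big_nil; split; last first.
    by under eq_Rintegral do rewrite big_nil; rewrite Rintegral_cst// mul0r.
  apply: (eq_integrable mD (cst 0%E)); last exact: integrable0.
  by move=> w _; rewrite /= big_nil.
have iVi := iV i (mem_head _ _).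
have [|ih1 ih2] := ih; first by move=> k ks; apply: iV; rewrite inE ks orbT.
split; last first.
  by rewrite big_cons -ih2 -RintegralD//; apply: eq_Rintegral => w _; rewrite big_cons.
have := integrableD mD iVi ih1.
by apply: eq_integrable => // w _; rewrite /= big_cons.
Qed.

End RintegralSum.

Section SquareIntegrable.
Context d (Omega : measurableType d) (R : realType) (P : probability Omega R).
Implicit Types U V : Omega -> R.

Lemma sqr_integrableM U V : measurable_fun setT U -> measurable_fun setT V ->
  P.-integrable setT (EFin \o (fun w => U w ^+ 2)) ->
  P.-integrable setT (EFin \o (fun w => V w ^+ 2)) ->
  P.-integrable setT (EFin \o (fun w => U w * V w)).
Proof.
move=> mU mV iU iV.
apply: (le_integrable measurableT _ _ (integrableD measurableT iU iV)).
  exact/measurable_EFinP/measurable_funM.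
move=> w _ /=; rewrite lee_fin [leRHS]ger0_norm ?addr_ge0 ?sqr_ge0//.
rewrite normrM -[U w ^+ 2]real_normK ?num_real// -[V w ^+ 2]real_normK ?num_real//.
have := sqr_ge0 (`|U w| - `|V w|); rewrite sqrrB mulr2n.
have := mulr_ge0 (normr_ge0 (U w)) (normr_ge0 (V w)); lra.
Qed.

Lemma sqr_integrable_integrable U : measurable_fun setT U ->
  P.-integrable setT (EFin \o (fun w => U w ^+ 2)) ->
  P.-integrable setT (EFin \o U).
Proof.
move=> mU iU; apply: (eq_integrable measurableT (EFin \o (fun w => U w * cst 1 w))).
  by move=> w _ /=; rewrite mulr1.
apply: sqr_integrableM => //.
rewrite (_ : (fun w => _) = cst 1); first exact: finite_measure_integrable_cst.
by apply/funext => w /=; rewrite expr1n.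
Qed.

Lemma bounded_integrable U c : measurable_fun setT U -> (forall w, `|U w| <= c) ->
  P.-integrable setT (EFin \o U).
Proof.
move=> mU Uc; apply: (le_integrable measurableT _ _
  (finite_measure_integrable_cst P c measurableT)); first exact/measurable_EFinP.
by move=> w _ /=; rewrite lee_fin (le_trans (Uc w)) ?ler_norm.
Qed.

Lemma sqr_mean_uncorrelated_sum (I : finType) (c : I -> R) (Z : I -> Omega -> R) :
  (forall i, measurable_fun setT (Z i)) ->
  (forall i, P.-integrable setT (EFin \o (fun w => Z i w ^+ 2))) ->
  (forall i j, i != j -> \int[P]_w (Z i w * Z j w) = 0) ->
  P.-integrable setT (EFin \o (fun w => (\sum_i c i * Z i w) ^+ 2)) /\
  \int[P]_w ((\sum_i c i * Z i w) ^+ 2) = \sum_i c i ^+ 2 * \int[P]_w (Z i w ^+ 2).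
Proof.
move=> mZ iZ Z0.
have iZZ i j : P.-integrable setT (EFin \o (fun w => Z i w * Z j w)).
  exact: sqr_integrableM.
pose S := fun w => \sum_i \sum_j (c i * c j) * (Z i w * Z j w).
have SE w : (\sum_i c i * Z i w) ^+ 2 = S w.
  rewrite expr2 mulr_suml; apply: eq_bigr => i _; rewrite mulr_sumr.
  by apply: eq_bigr => j _; rewrite mulrACA.
have iij i j : P.-integrable setT (EFin \o (fun w => (c i * c j) * (Z i w * Z j w))).
  exact: (integrableZl measurableT (c i * c j) (iZZ i j)).
have ii i := Rintegral_sum (s := index_enum I) measurableT (fun j _ => iij i j).
have [iS SI] := Rintegral_sum (s := index_enum I) measurableT (fun i _ => proj1 (ii i)).
have -> : (fun w => (\sum_i c i * Z i w) ^+ 2) = S by apply/funext.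
split=> //; rewrite SI; apply: eq_bigr => i _.
rewrite (proj2 (ii i)) (bigD1 i)//= big1 ?addr0 => [|j ji].
  by rewrite RintegralZl// -expr2; congr (_ * _); apply: eq_Rintegral.
by rewrite RintegralZl// Z0 ?mulr0// eq_sym.
Qed.

End SquareIntegrable.

Section Independence.
Context d (Omega : measurableType d) (R : realType) (P : probability Omega R).

Definition independent2 d1 d2 (T1 : measurableType d1) (T2 : measurableType d2)
    (U : Omega -> T1) (V : Omega -> T2) : Prop :=
  forall A B, measurable A -> measurable B ->
    (P (U @^-1` A `&` V @^-1` B) = P (U @^-1` A) * P (V @^-1` B))%E.

Lemma independent2_comp d1 d2 d3 d4 (T1 : measurableType d1)
    (T2 : measurableType d2) (S1 : measurableType d3) (S2 : measurableType d4)
    (U : Omega -> T1) (V : Omega -> T2) (f : T1 -> S1) (g : T2 -> S2) :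
  measurable_fun setT f -> measurable_fun setT g ->
  independent2 U V -> independent2 (f \o U) (g \o V).
Proof.
move=> mf mg UV A B mA mB; apply: (UV (f @^-1` A) (g @^-1` B)).
  by rewrite -[X in measurable X]setTI; exact: mf.
by rewrite -[X in measurable X]setTI; exact: mg.
Qed.

(** The law of the pair is the product of the two laws, by uniqueness of the product measure on
    rectangles, and Fubini splits the integral. *)
Lemma integral_mul_independent2 (U V : Omega -> R) :
  measurable_fun setT U -> measurable_fun setT V -> independent2 U V ->
  P.-integrable setT (EFin \o U) -> P.-integrable setT (EFin \o V) ->
  P.-integrable setT (EFin \o (fun w => U w * V w)) ->
  \int[P]_w (U w * V w) = (\int[P]_w U w) * (\int[P]_w V w).
Proof.
move=> mU mV UV iU iV iUV.
pose Um : {mfun Omega >-> R} := HB.pack U (isMeasurableFun.Build _ _ _ _ U mU).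
pose Vm : {mfun Omega >-> R} := HB.pack V (isMeasurableFun.Build _ _ _ _ V mV).
pose UVf : Omega -> R * R := fun w => (U w, V w).
have mUV : measurable_fun setT UVf by exact: measurable_fun_pair.
pose mixin := isMeasurableFun.Build _ _ _ _ UVf mUV.
pose UVm : {mfun Omega >-> (R * R)%type} := HB.pack UVf mixin.
pose m1 := distribution P Um; pose m2 := distribution P Vm.
pose m := distribution P UVm.
have mE (A : set (R * R)) : measurable A -> ((m1 \x m2) A = m A)%E.
  by apply: product_measure_unique => A1 A2 mA1 mA2; rewrite -UV.
pose f : R * R -> \bar R := fun z => (z.1 * z.2)%:E.
have mf : measurable_fun setT f by exact/measurable_EFinP/measurable_funM.
have iE (g : R * R -> \bar R) : (\int[(m1 \x m2)%E]_z g z = \int[m]_z g z)%E.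
  by apply: eq_measure_integral => A mA _; exact: mE.
have if1 : (m1 \x m2)%E.-integrable setT f.
  have /integrableP[_ im] : m.-integrable setT f.
    by apply: integrable_pushforward => //.
  by apply/integrableP; split => //; rewrite iE.
have -> : \int[P]_w (U w * V w) = fine (\int[m]_z f z).
  by rewrite /m integral_distribution.
rewrite -iE -integral12_prod_meas1//.
have mid : measurable_fun [set: R] (@EFin R) by [].
have iV2 : m2.-integrable setT (@EFin R) by exact: integrable_pushforward.
have iU1 : m1.-integrable setT (@EFin R) by exact: integrable_pushforward.
have EV : (\int[m2]_y y%:E = (\int[P]_w V w)%:E)%E.
  by rewrite /m2 integral_distribution// /Rintegral fineK// integrable_fin_num.
have EU : (\int[m1]_y y%:E = (\int[P]_w U w)%:E)%E.
  by rewrite /m1 integral_distribution// /Rintegral fineK// integrable_fin_num.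
transitivity (fine (\int[m1]_x ((\int[P]_w V w)%:E * x%:E))%E).
  congr fine; apply: eq_integral => x _; rewrite /fubini_F /f /=.
  by under eq_integral do rewrite EFinM; rewrite integralZl// EV muleC.
by rewrite integralZl// EU -EFinM mulrC.
Qed.

(* pi-lambda: the product rule on rectangles propagates to the product
   sigma-algebra. *)
Lemma pair_independent_event d1 d2 (T1 : measurableType d1)
    (T2 : measurableType d2) (U : {mfun Omega >-> T1}) (V : {mfun Omega >-> T2})
    (C : set Omega) : measurable C ->
  (forall A B, measurable A -> measurable B ->
    P ((U @^-1` A `&` V @^-1` B) `&` C) = (P (U @^-1` A `&` V @^-1` B) * P C)%E) ->
  forall A, measurable A ->
    P ((fun w => (U w, V w)) @^-1` A `&` C) = (P ((fun w => (U w, V w)) @^-1` A) * P C)%E.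
Proof.
move=> mC rect.
pose UVf : Omega -> T1 * T2 := fun w => (U w, V w).
have mUV : measurable_fun setT UVf by exact: measurable_fun_pair.
pose mixin := isMeasurableFun.Build _ _ _ _ UVf mUV.
pose UVm : {mfun Omega >-> (T1 * T2)%type} := HB.pack UVf mixin.
pose PC := fine (P C).
have PCE : P C = PC%:E by rewrite fineK// fin_num_measure.
have PC0 : 0 <= PC by rewrite fine_ge0.
pose m1' : {measure set (T1 * T2) -> \bar R} := pushforward (mrestr P mC) UVm.
pose m1 := m1' mUV.
pose m2 : {measure set (T1 * T2) -> \bar R} := mscale (NngNum PC0) (distribution P UVm).
pose G : set (set (T1 * T2)) :=
  [set A1 `*` A2 | A1 in measurable & A2 in measurable].
have m2E A : m2 A = (P (UVf @^-1` A) * P C)%E by rewrite PCE muleC.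
have m1E A : m1 A = P (UVf @^-1` A `&` C) by [].
move=> A mA; rewrite -[LHS](m1E A) -[RHS](m2E A).
apply: (measure_unique G (fun=> setT)) => //.
- by rewrite measurable_prod_measurableType.
- move=> _ _ [A1 mA1 [A2 mA2 <-]] [B1 mB1 [B2 mB2 <-]]; rewrite -setXI.
  by exists (A1 `&` B1); [exact: measurableI|exists (A2 `&` B2); [exact: measurableI|]].
- by move=> i; exists setT => //; exists setT => //; rewrite setXTT.
- by rewrite bigcup_const//; exists 0%N.
- by move=> _ [A1 mA1 [A2 mA2 <-]]; rewrite m1E m2E; exact: rect.
- by move=> k; rewrite m1E preimage_setT setTI -ge0_fin_numE ?measure_ge0// fin_num_measure.
Qed.

Context (I : finType) (V : I -> {mfun Omega >-> R}).
Hypothesis Vind : mutually_independent P (fun i => V i : Omega -> R).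

Lemma mutually_independent_seq (s : seq I) (A : I -> set R) :
  uniq s -> (forall i, measurable (A i)) ->
  P (\big[setI/setT]_(i <- s) (V i @^-1` A i)) = (\prod_(i <- s) P (V i @^-1` A i))%E.
Proof.
move=> us mA; pose A' i := if i \in s then A i else setT.
have mA' i : measurable (A' i) by rewrite /A'; case: ifP.
have -> : \big[setI/setT]_(i <- s) (V i @^-1` A i) = [set w | forall i, A' i (V i w)].
  rewrite -bigcap_seq; apply/seteqP; split => w /= h i.
    by rewrite /A'; case: ifPn => // /h.
  by move=> /= si; have := h i; rewrite /A' si.
rewrite Vind// (bigID (mem s))/= [X in (_ * X)%E]big1 ?mule1; last first.
  by move=> i /negbTE si; rewrite /A' si preimage_setT probability_setT.
rewrite -big_uniq//; apply: eq_big_seq => i si.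
by rewrite /A' si.
Qed.

Lemma mutually_independent2 i j : i != j -> independent2 (V i) (V j).
Proof.
move=> ij A B mA mB.
pose F k := if k == i then A else B.
have := @mutually_independent_seq [:: i; j] F.
rewrite /= inE ij /F /= !big_cons !big_nil setIT mule1 eqxx eq_sym (negbTE ij).
by apply => // k; case: ifP.
Qed.

Lemma mutually_independent_pairl i j k : uniq [:: i; j; k] ->
  independent2 (fun w => (V i w, V j w)) (V k).
Proof.
move=> u A B mA mB; apply: pair_independent_event => //.
  by rewrite -[X in measurable X]setTI; exact: measurable_funP.
move=> C D mC mD.
pose F l := if l == i then C else if l == j then D else B.
have mF l : measurable (F l) by rewrite /F; do 2 case: ifP => //.
have := mutually_independent_seq u mF.
move: u; rewrite /= !inE negb_or !andbT => /andP[/andP[ij ik] jk].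
have := @mutually_independent_seq [:: i; j] F; rewrite /= inE ij => /(_ isT mF).
rewrite /F !big_cons !big_nil !setIT !mule1 !eqxx.
by rewrite ![_ == i]eq_sym (negbTE ij) (negbTE ik) ![k == j]eq_sym (negbTE jk)
  setIA muleA => -> ->.
Qed.

(** [pair_independent_event] is used once per pair: for the first pair against the event of the
    second, then for the second pair against a rectangle of the first. *)
Lemma mutually_independent_pairs i j k l : uniq [:: i; j; k; l] ->
  independent2 (fun w => (V i w, V j w)) (fun w => (V k w, V l w)).
Proof.
move=> u A B mA mB.
have mkl : measurable ((fun w => (V k w, V l w)) @^-1` B).
  rewrite -[X in measurable X]setTI.
  have : measurable_fun setT (fun w => (V k w, V l w)) by exact: measurable_fun_pair.
  exact.
apply: pair_independent_event => // C D mC mD.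
rewrite setIC muleC; apply: pair_independent_event => //.
  by apply: measurableI; rewrite -[X in measurable X]setTI; exact: measurable_funP.
move=> E F mE mF; rewrite muleC setIC.
pose G n := if n == i then C else if n == j then D else if n == k then E else F.
have mG n : measurable (G n) by rewrite /G; do 3 case: ifP => //.
have := mutually_independent_seq u mG.
move: u; rewrite /= !inE !negb_or !andbT => /and3P[/and3P[ij ik il] /andP[jk jl] kl].
have := @mutually_independent_seq [:: i; j] G; rewrite /= inE ij => /(_ isT mG).
have := @mutually_independent_seq [:: k; l] G; rewrite /= inE kl => /(_ isT mG).
rewrite /G !big_cons !big_nil !setIT !mule1 !eqxx.
rewrite ![_ == i]eq_sym (negbTE ij) (negbTE ik) (negbTE il) ![_ == j]eq_sym
  (negbTE jk) (negbTE jl) [l == k]eq_sym (negbTE kl).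
by move=> Ekl Eij; rewrite Ekl Eij -setIA -muleA.
Qed.

End Independence.

(** * Clipped sample means *)

Section Clipping.
Context (R : realType).
Implicit Types tau x y e t F : R.

Lemma clip_bound tau x : 0 <= tau -> `|clip tau x| <= tau.
Proof.
move=> t0; rewrite /clip ler_norml le_max lexx/= ge_max ge_min lexx orbT andbT.
by apply: (le_trans _ t0); rewrite oppr_le0.
Qed.

(** Clipping acts only if |y + e| > F + t, hence |e| > t, and then moves the value by |y + e| - (F +
    t) <= |e| - t. *)
Lemma clip_excess F t y e : `|y| <= F -> 0 <= t ->
  `|clip (F + t) (y + e) - (y + e)| <= Num.max (`|e| - t) 0.
Proof.
rewrite ler_norml => /andP[Fy yF] t0; rewrite ler_norml.
have e1 := ler_norm e; have e2 := lerNnormlW (lexx `|e|); have e0 := normr_ge0 e.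
rewrite /clip; have [h1|h1] := leP (y + e) (F + t);
  have [h2|h2] := leP (- (F + t)) _; have [h3|h3] := leP 0 (`|e| - t); apply/andP; split; lra.
Qed.

Lemma measurable_clip tau : measurable_fun setT (clip tau).
Proof. by apply: measurable_maxr => //; apply: measurable_minr. Qed.

End Clipping.

Section ClippedProduct.
Context (R : realType) d (Omega : measurableType d) (P : probability Omega R).
Local Notation mu := (@lebesgue_measure R).
Variables (f g : R -> R) (F G t : R).
Hypotheses (mf : measurable_fun setT f) (mg : measurable_fun setT g).
Hypotheses (fF : forall x, `|f x| <= F) (gG : forall x, `|g x| <= G) (t0 : 0 <= t).

(** The contribution of one observation to a local estimate, with [g] in the role of the wavelet
    kernel. The argument is (design point, error), not the pair (Y, X). *)
Definition clipped_product (z : R * R) : R := clip (F + t) (f z.1 + z.2) * g z.1.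

Let F0 : 0 <= F. Proof. exact: le_trans (fF 0). Qed.
Let tau0 : 0 <= F + t. Proof. exact: addr_ge0. Qed.

Lemma measurable_clipped_product : measurable_fun setT clipped_product.
Proof.
apply: measurable_funM; last exact: measurableT_comp.
apply: (measurableT_comp (measurable_clip (F + t))).
by apply: measurable_funD => //; exact: measurableT_comp.
Qed.

Lemma clipped_product_bound z : `|clipped_product z| <= (F + t) * `|g z.1|.
Proof. by rewrite normrM ler_wpM2r// clip_bound. Qed.

Variables (X xi : {RV P >-> R}).
Hypotheses (XU : has_law P X (uniform_prob (@ltr01 R))).
Hypotheses (xiN : has_law P xi (normal_prob 0 1)) (Xxi : independent2 P X xi).

Let H w := clipped_product (X w, xi w).

Let mH : measurable_fun setT H.
Proof.
apply: measurableT_comp; first exact: measurable_clipped_product.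
exact: measurable_fun_pair.
Qed.

Let mgX : measurable_fun setT (g \o X). Proof. exact: measurableT_comp. Qed.
Let mfX : measurable_fun setT (f \o X). Proof. exact: measurableT_comp. Qed.

Lemma clipped_product_integrable : P.-integrable setT (EFin \o H).
Proof.
apply: (@bounded_integrable _ _ _ _ _ ((F + t) * G)) => // w.
by apply: (le_trans (clipped_product_bound _)); rewrite ler_wpM2l.
Qed.

Lemma clipped_product_sqr_integrable : P.-integrable setT (EFin \o (fun w => H w ^+ 2)).
Proof.
apply: (@bounded_integrable _ _ _ _ _ (((F + t) * G) ^+ 2)).
  exact: measurable_funX.
move=> w; rewrite normrX ler_pXn2r ?nnegrE//.
  by apply: (le_trans (clipped_product_bound _)); rewrite ler_wpM2l.
by rewrite mulr_ge0// (le_trans _ (gG 0)).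
Qed.

Let igX : P.-integrable setT (EFin \o (g \o X)).
Proof. by apply: (@bounded_integrable _ _ _ _ _ G) => // w; exact: gG. Qed.

Lemma Rintegral_uniform_law (h : R -> R) : measurable_fun setT h ->
  \int[P]_w h (X w) = \int[mu]_(x in `[0, 1]) h x.
Proof.
move=> mh; rewrite /Rintegral -[RHS](congr1 fine (integral_uniform_law XU _))//.
exact/measurable_EFinP.
Qed.

Lemma clipped_product_sqr_le :
  \int[P]_w (H w ^+ 2) <= (F + t) ^+ 2 * \int[mu]_(x in `[0, 1]) (g x ^+ 2).
Proof.
have mg2 : measurable_fun setT (fun x => g x ^+ 2) by exact: measurable_funX.
have ig2 : P.-integrable setT (EFin \o (fun w => g (X w) ^+ 2)).
  apply: (@bounded_integrable _ _ _ _ _ (G ^+ 2)).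
    exact: (measurableT_comp mg2).
  by move=> w; rewrite normrX ler_pXn2r ?nnegrE// (le_trans _ (gG 0)).
rewrite -Rintegral_uniform_law// -RintegralZl//.
apply: le_Rintegral => //.
- exact: clipped_product_sqr_integrable.
- exact: (integrableZl measurableT ((F + t) ^+ 2) ig2).
move=> w _; rewrite -exprMn -[leLHS]real_normK ?num_real//.
rewrite -[leRHS]real_normK ?num_real// ler_pXn2r ?nnegrE//.
by apply: (le_trans (clipped_product_bound _)); rewrite normrM [`|F + t|]ger0_norm.
Qed.

(* Only the clipping biases the mean, since [xi] is centered and independent
   of [X]. *)
Lemma clipped_product_mean :
  `|\int[P]_w H w - \int[mu]_(x in `[0, 1]) (f x * g x)| <=
  4 * expR (- (t ^+ 2 / 4)) * \int[mu]_(x in `[0, 1]) `|g x|.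
Proof.
have iH := clipped_product_integrable.
have mgn : measurable_fun setT (Num.norm \o g) by exact: measurableT_comp.
have mgXn : measurable_fun setT (Num.norm \o (g \o X)) by exact: measurableT_comp.
have mfg : measurable_fun setT (fun x => f x * g x) by exact: measurable_funM.
have G0 : 0 <= G by rewrite (le_trans _ (gG 0)).
have ifg : P.-integrable setT (EFin \o (fun w => f (X w) * g (X w))).
  apply: (@bounded_integrable _ _ _ _ _ (F * G)).
    exact: measurable_funM.
  by move=> w; rewrite normrM ler_pM.
have ixi := normal_integrable xiN.
have [iM leM] := normal_excess xiN t0.
have bg : [bounded (g \o X) w | w in [set: Omega]].
  by exists G; split; [exact: num_real|move=> x Gx w _; exact: le_trans (gG _) (ltW Gx)].
have ixg : P.-integrable setT (EFin \o (fun w => xi w * g (X w))).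
  by have := integrableMl measurableT ixi mgX bg.
have bgn : [bounded (Num.norm \o (g \o X)) w | w in [set: Omega]].
  exists G; split; [exact: num_real|move=> x Gx w _ /=].
  by rewrite normr_id; exact: le_trans (gG _) (ltW Gx).
pose M w := Num.max (`|xi w| - t) 0.
have mM : measurable_fun setT (fun x : R => Num.max (`|x| - t) 0).
  by apply: measurable_maxr => //; apply: measurable_funB => //; exact: measurableT_comp.
have iMg : P.-integrable setT (EFin \o (fun w => M w * `|g (X w)|)).
  by have := integrableMl measurableT iM mgXn bgn.
have E1 : \int[P]_w (xi w * g (X w)) = 0.
  rewrite (integral_mul_independent2 _ mgX) ?(normal_mean0 xiN) ?mul0r//.
  move=> A B mA mB; rewrite setIC muleC.
  exact: (independent2_comp mg (@measurable_id _ _ setT) Xxi).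
have E2 : \int[P]_w (M w * `|g (X w)|) =
    (\int[P]_w M w) * \int[mu]_(x in `[0, 1]) `|g x|.
  rewrite (integral_mul_independent2 _ mgXn)//.
  - by rewrite (Rintegral_uniform_law mgn).
  - exact: (measurableT_comp mM).
  - move=> A B mA mB; rewrite setIC muleC.
    exact: (independent2_comp mgn mM Xxi).
  - exact: integrable_norm igX.
have E3 : \int[P]_w (f (X w) * g (X w)) =
    \int[P]_w (f (X w) * g (X w) + xi w * g (X w)).
  by rewrite RintegralD// E1 addr0.
rewrite -(Rintegral_uniform_law mfg) E3.
have iS : P.-integrable setT
    (EFin \o (fun w => f (X w) * g (X w) + xi w * g (X w))).
  exact: (integrableD measurableT ifg ixg).
rewrite -RintegralB//.
apply: (le_trans (le_normr_Rintegral measurableT _)).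
  exact: (integrableB measurableT iH iS).
apply: (@le_trans _ _ (\int[P]_w (M w * `|g (X w)|))).
  apply: le_Rintegral => //.
    apply: (integrable_norm (f := fun w => H w - (f (X w) * g (X w) + xi w * g (X w)))).
    exact: (integrableB measurableT iH iS).
  move=> w _; rewrite -mulrDl /H /clipped_product/= -mulrBl normrM ler_wpM2r//.
  exact: clip_excess.
by rewrite E2; apply: ler_wpM2r => //; apply: Rintegral_ge0.
Qed.

End ClippedProduct.

(** * Bias and variance of a weighted average over the servers *)

Section SamplingRisk.
Context (R : realType) d (Omega : measurableType d) (P : probability Omega R).
Local Notation mu := (@lebesgue_measure R).
Context (m : nat) (n : 'I_m -> nat) (b : 'I_m -> R).
Variables (X xi : forall j, 'I_(n j) -> {RV P >-> R}) (W : 'I_m -> {RV P >-> R}).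
Hypothesis model : sampling_model b X xi W.
Hypotheses (b0 : forall j, 0 <= b j) (n0 : forall j, (0 < n j)%N).

Local Notation obs := {j : 'I_m & 'I_(n j)}.

(** The family [primitives] with its members bundled as measurable functions, the form that the
    independence lemmas take. *)
Definition primitive_variable (i : obs + obs + 'I_m) : {mfun Omega >-> R} :=
  match i with
  | inl (inl o) => X (tagged o)
  | inl (inr o) => xi (tagged o)
  | inr j => W j
  end.

Lemma primitive_variable_independent :
  mutually_independent P (fun i => primitive_variable i : Omega -> R).
Proof.
have [_ _ _ _] := model; congr (mutually_independent P _).
by apply/funext => -[[[j i]|[j i]]|j].
Qed.

Variables (f g : R -> R) (F G t : R) (u : 'I_m -> R).
Hypotheses (mf : measurable_fun setT f) (mg : measurable_fun setT g).
Hypotheses (fF : forall x, `|f x| <= F) (gG : forall x, `|g x| <= G) (t0 : 0 <= t).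
Hypotheses (u0 : forall j, 0 <= u j) (u1 : \sum_j u j = 1).

Let Xlaw (o : obs) : has_law P (X (tagged o)) (uniform_prob (@ltr01 R)).
Proof. by case: model. Qed.

Let xilaw (o : obs) : has_law P (xi (tagged o)) (normal_prob 0 1).
Proof. by case: model. Qed.

Let Wlaw j : has_law P (W j) (laplace_prob 0 (b j)).
Proof. by case: model. Qed.

Let Xxi (o : obs) : independent2 P (X (tagged o)) (xi (tagged o)).
Proof.
exact: (mutually_independent2 primitive_variable_independent
  (i := inl (inl o)) (j := inl (inr o))).
Qed.

Let h := clipped_product f g F t.
Let mh : measurable_fun setT h. Proof. exact: measurable_clipped_product. Qed.

Let H (o : obs) w := h (X (tagged o) w, xi (tagged o) w).
Let e (o : obs) := \int[P]_w H o w.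

(** Centred observations and privacy noises form one family, with coefficients [c]. Its members are
    pairwise uncorrelated, so the second moment of the random part of the error is a single sum of
    squares. *)
Let Z (i : obs + 'I_m) w : R :=
  match i with inl o => H o w - e o | inr j => W j w end.

Let c (i : obs + 'I_m) : R :=
  match i with inl o => u (tag o) / (n (tag o))%:R | inr j => u j end.

Let mH o : measurable_fun setT (H o).
Proof. by apply: (measurableT_comp mh); exact: measurable_fun_pair. Qed.

Let mZ i : measurable_fun setT (Z i).
Proof. by case: i => [ o|j] //=; exact: measurable_funB. Qed.

Let iH o : P.-integrable setT (EFin \o H o).
Proof. exact: (clipped_product_integrable mf mg fF gG t0). Qed.

Let iH2 o : P.-integrable setT (EFin \o (fun w => H o w ^+ 2)).
Proof. exact: (clipped_product_sqr_integrable mf mg fF gG t0). Qed.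

Let icst (a : R) : P.-integrable setT (EFin \o cst a).
Proof. exact: finite_measure_integrable_cst. Qed.

Let cstE (a : R) : \int[P]_w a = a.
Proof. by rewrite Rintegral_cst//= probability_setT mulr1. Qed.

Let centered_sqr o w : Z (inl o) w ^+ 2 = H o w ^+ 2 + ((- 2 * e o) * H o w + e o ^+ 2).
Proof. by rewrite /=; ring. Qed.

Let iZ2 i : P.-integrable setT (EFin \o (fun w => Z i w ^+ 2)).
Proof.
case: i => [ o|j]; last exact: (laplace_integrable_sqr (b0 j) (Wlaw j)).
under eq_fun do rewrite centered_sqr.
have i1 := integrableZl measurableT (- 2 * e o) (iH o).
exact: (integrableD measurableT (iH2 o) (integrableD measurableT i1 (icst (e o ^+ 2)))).
Qed.

Let Z2_inl o : \int[P]_w (Z (inl o) w ^+ 2) <=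
  (F + t) ^+ 2 * \int[mu]_(x in `[0, 1]) (g x ^+ 2).
Proof.
apply: le_trans (clipped_product_sqr_le mf mg fF gG t0 (xi (tagged o)) (Xlaw o)).
under eq_Rintegral do rewrite centered_sqr.
have i1 : P.-integrable setT (EFin \o (fun w => (- 2 * e o) * H o w)).
  exact: (integrableZl measurableT (- 2 * e o) (iH o)).
have i2 := integrableD measurableT i1 (icst (e o ^+ 2)).
have E1 : \int[P]_w ((- 2 * e o) * H o w) = (- 2 * e o) * e o.
  exact: (RintegralZl (- 2 * e o) measurableT (iH o)).
have ie : P.-integrable setT (EFin \o (fun=> e o ^+ 2)) by exact: icst.
rewrite RintegralD// RintegralD// E1 cstE -/(H o).
have := sqr_ge0 (e o); lra.
Qed.

Let Z2_inr j : \int[P]_w (Z (inr j) w ^+ 2) <= 16 * b j ^+ 2.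
Proof.
have := laplace_sqr_le (b0 j) (Wlaw j).
have /fineK <- := integrable_fin_num measurableT (iZ2 (inr j)).
by rewrite lee_fin.
Qed.

Let Zmean i : \int[P]_w Z i w = 0.
Proof.
case: i => [ o|j]; last exact: (laplace_mean0 (b0 j) (Wlaw j)).
by rewrite (RintegralB measurableT (iH o) (icst _)) cstE subrr.
Qed.

(** [Z (inl o)] is a function of the pair (X, xi) of [o] alone: two observations call for
    independence of two pairs, an observation and a noise for a pair against a single variable. *)
Let Zind i i' : i != i' -> independent2 P (Z i) (Z i').
Proof.
have pairl (o : obs) j : independent2 P (Z (inl o)) (W j).
  have := mutually_independent_pairl primitive_variable_independent
    (i := inl (inl o)) (j := inl (inr o)) (k := inr j) isT.
  apply: (independent2_comp (f := fun z => h z - e o) (g := id)) => //.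
  exact: measurable_funB.
case: i i' => [ o|j] [ o'|j'] // ii'.
- have oo : o != o' by apply: contra ii' => /eqP ->.
  have l : (inl (inl o) != inl (inl o') :> obs + obs + 'I_m).
    by apply: contra oo => /eqP[->].
  have r : (inl (inr o) != inl (inr o') :> obs + obs + 'I_m).
    by apply: contra oo => /eqP[->].
  have uo : uniq [:: inl (inl o); inl (inr o); inl (inl o'); inl (inr o') : obs + obs + 'I_m].
    by rewrite /= !inE (negbTE l) (negbTE r).
  have := mutually_independent_pairs primitive_variable_independent uo.
  by apply: (independent2_comp (f := fun z => h z - e o) (g := fun z => h z - e o'));
    exact: measurable_funB.
- exact: pairl.
- by move=> A B mA mB; rewrite setIC muleC; exact: pairl.
- exact: (mutually_independent2 primitive_variable_independent
    (i := inr j) (j := inr j')).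
Qed.

Let Zuncorr i i' : i != i' -> \int[P]_w (Z i w * Z i' w) = 0.
Proof.
move=> ii'; rewrite integral_mul_independent2 ?Zmean ?mul0r//.
- exact: Zind.
- exact: sqr_integrable_integrable.
- exact: sqr_integrable_integrable.
- exact: sqr_integrableM.
Qed.

Lemma sum_obs (S : 'I_m -> R) : \sum_(o : obs) S (tag o) / (n (tag o))%:R = \sum_j S j.
Proof.
rewrite -(sig_big_dep xpredT (fun _ _ => true) (fun j _ => S j / (n j)%:R)) /=.
apply: eq_bigr => j _; rewrite sumr_const card_ord -[LHS]mulr_natr divfK//.
by rewrite pnatr_eq0 -lt0n.
Qed.

Variable a : R.

Definition averaged_error (w : Omega) : R :=
  \sum_j u j * ((n j)%:R^-1 * \sum_(i < n j) h (X i w, xi i w) + W j w) - a.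

Let bias := \sum_(o : obs) c (inl o) * (e o - a).

Let averaged_errorE w : averaged_error w = \sum_i c i * Z i w + bias.
Proof.
rewrite /averaged_error /bias big_sumType/=.
(* The coefficients of all observations sum to 1, so the target [a] can be spread over them. *)
have -> : \sum_(o : obs) c (inl o) * (e o - a) = \sum_(o : obs) c (inl o) * e o - a.
  under eq_bigr do rewrite mulrBr.
  by rewrite sumrB -mulr_suml /= sum_obs u1 mul1r.
under eq_bigr do rewrite mulrDr.
rewrite big_split/= addrA; congr (_ - _).
have -> : \sum_(o : obs) c (inl o) * Z (inl o) w =
    \sum_(o : obs) c (inl o) * H o w - \sum_(o : obs) c (inl o) * e o.
  by rewrite -sumrB; apply: eq_bigr => o _; rewrite -mulrBr.
rewrite addrAC subrK; congr (_ + _).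
rewrite -(sig_big_dep xpredT (fun _ _ => true)
  (fun j i => u j / (n j)%:R * h (X i w, xi i w))) /=.
by apply: eq_bigr => j _; rewrite mulrA -mulr_sumr.
Qed.

(** The bound (S + bias)^2 <= 2 S^2 + 2 bias^2 spares the integral of the cross term and is the
    origin of the two factors 2. *)
Lemma averaged_risk_le :
  ('E_P[fun w => (averaged_error w ^+ 2)%R] <=
   (2 * (`|\int[mu]_(x in `[0, 1]) (f x * g x) - a| +
         4 * expR (- (t ^+ 2 / 4)) * \int[mu]_(x in `[0, 1]) `|g x|) ^+ 2 +
    2 * \sum_j u j ^+ 2 *
      ((F + t) ^+ 2 * \int[mu]_(x in `[0, 1]) (g x ^+ 2) / (n j)%:R +
       16 * b j ^+ 2))%:E)%E.
Proof.
pose S w := \sum_i c i * Z i w.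
have [iS ES] := sqr_mean_uncorrelated_sum c mZ iZ2 Zuncorr.
have mS : measurable_fun setT S.
  by apply: measurable_sum => i; exact: measurable_funM.
set I2 := \int[mu]_(x in `[0, 1]) (g x ^+ 2).
set be := `|_ - a| + _.
have cge0 i : 0 <= c i by case: i => [ o|j] /=; rewrite ?divr_ge0.
have bias_le : `|bias| <= be.
  rewrite (le_trans (ler_norm_sum _ _ _))//.
  apply: (@le_trans _ _ (\sum_(o : obs) c (inl o) * be)).
    apply: ler_sum => o _; rewrite normrM ger0_norm// ler_wpM2l//.
    rewrite -(subrKA (\int[mu]_(x in `[0, 1]) (f x * g x))) addrC.
    rewrite (le_trans (ler_normD _ _))// lerD//.
    exact: (clipped_product_mean mf mg fF gG t0 (Xlaw o) (xilaw o) (Xxi o)).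
  by rewrite -mulr_suml /= sum_obs u1 mul1r.
have ES_le : \int[P]_w (S w ^+ 2) <= \sum_j u j ^+ 2 *
    ((F + t) ^+ 2 * I2 / (n j)%:R + 16 * b j ^+ 2).
  rewrite ES big_sumType/=.
  apply: (@le_trans _ _ (\sum_(o : obs) c (inl o) ^+ 2 * ((F + t) ^+ 2 * I2) +
      \sum_j u j ^+ 2 * (16 * b j ^+ 2))).
    apply: lerD; apply: ler_sum => i _; (apply: ler_wpM2l; first exact: sqr_ge0).
      exact: Z2_inl.
    exact: Z2_inr.
  under [leRHS]eq_bigr do rewrite mulrDr.
  rewrite big_split/= lerD2r le_eqVlt; apply/orP; left; apply/eqP.
  rewrite -(sum_obs (fun j => u j ^+ 2 * ((F + t) ^+ 2 * I2 / (n j)%:R))).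
  apply: eq_bigr => o _ /=; field.
  by rewrite pnatr_eq0 -lt0n.
rewrite unlock; apply: (@le_trans _ _ (\int[P]_w (2 * be ^+ 2 + 2 * S w ^+ 2)%:E)%E).
  apply: ge0_le_integral => //.
  - by move=> w _; rewrite lee_fin sqr_ge0.
  - apply/measurable_EFinP/measurable_funX.
    rewrite (_ : averaged_error = fun w => S w + bias); last exact/funext.
    exact: measurable_funD.
  - apply/measurable_EFinP/measurable_funD => //.
    by apply: measurable_funM => //; exact: measurable_funX.
  - move=> w _; rewrite lee_fin averaged_errorE -/(S w).
    apply: (@le_trans _ _ (2 * bias ^+ 2 + 2 * S w ^+ 2)).
      have := sqr_ge0 (S w - bias); lra.
    rewrite lerD2r ler_wpM2l// -real_normK ?num_real//.
    by rewrite ler_pXn2r ?nnegrE// (le_trans (normr_ge0 _) bias_le).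
have i2 := integrableZl measurableT 2 iS.
have iS2 : (\int[P]_w (S w ^+ 2)%:E = (\int[P]_w (S w ^+ 2))%:E)%E.
  by rewrite /Rintegral fineK// (integrable_fin_num measurableT iS).
have -> : (\int[P]_w (2 * be ^+ 2 + 2 * S w ^+ 2)%:E =
    (2 * be ^+ 2)%:E + 2%:E * (\int[P]_w (S w ^+ 2))%:E)%E.
  rewrite (integralD measurableT (icst (2 * be ^+ 2)) i2) integralZl// iS2.
  congr (_ + _)%E; transitivity (\int[P]_w (cst (2 * be ^+ 2)%:E w))%E => //.
  by rewrite integral_cst//= probability_setT mule1.
by rewrite -EFinM -EFinD lee_fin lerD2l ler_wpM2l.
Qed.

End SamplingRisk.

(** * Uniform bounds on the wavelets *)

Section BoundedContinuous.
Context {R : realType}.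
Implicit Types f g : R -> R.

Definition bounded_continuous g := continuous g /\ exists K, forall x, `|g x| <= K.

Lemma bounded_continuousZ c g : bounded_continuous g -> bounded_continuous (fun x => c * g x).
Proof.
move=> [cg [K gK]]; split; first by move=> x; apply: cvgM; [exact: cvg_cst|exact: cg].
by exists (`|c| * K) => x; rewrite normrM ler_wpM2l.
Qed.

Lemma bounded_continuous_sum (I : Type) (s : seq I) (Q : pred I) (g : I -> R -> R) :
  (forall i, bounded_continuous (g i)) ->
  bounded_continuous (fun x => \sum_(i <- s | Q i) g i x).
Proof.
move=> bg; elim: s => [|i s [ih1 [K ih2]]].
  split; last by exists 0 => x; rewrite big_nil normr0.
  by under eq_fun do rewrite big_nil; exact: cst_continuous.
have [cg [K' gK']] := bg i.
have [Qi|nQi] := boolP (Q i); last first.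
  under eq_fun do rewrite big_cons (negbTE nQi).
  by split=> //; exists K.
under eq_fun do rewrite big_cons Qi.
split; first by move=> x; apply: cvgD; [exact: cg|exact: ih1].
by exists (K' + K) => x; rewrite (le_trans (ler_normD _ _))// lerD.
Qed.

Lemma bounded_continuous_comp g h : continuous h -> bounded_continuous g ->
  bounded_continuous (g \o h).
Proof.
move=> ch [cg [K gK]]; split; last by exists K => x; exact: gK.
by move=> x; apply: continuous_comp; [exact: ch|exact: cg].
Qed.

Lemma bounded_within_segment f (a b : R) : {within `[a, b], continuous f} ->
  exists2 K, 0 <= K & forall x, a <= x <= b -> `|f x| <= K.
Proof.
move=> cf; have [K [_ KP]] := compact_bounded (continuous_compact cf (@segment_compact _ a b)).
exists (`|K| + 1) => [|x xab]; first by rewrite addr_ge0.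
apply: KP; first by rewrite (le_lt_trans (ler_norm _))// ltrDl.
by exists x => //=; rewrite in_itv.
Qed.

Lemma compact_support_bounded f (a b : R) : continuous f ->
  (forall x, x < a \/ b < x -> f x = 0) -> bounded_continuous f.
Proof.
move=> cf f0; split=> //.
have [K K0 fK] := bounded_within_segment (continuous_subspaceT cf : {within `[a, b], continuous f}).
exists K => x; have [xa|ax] := ltP x a; first by rewrite f0 ?normr0//; left.
have [bx|xb] := ltP b x; first by rewrite f0 ?normr0//; right.
by rewrite fK// ax.
Qed.

Lemma uniform_bound (m : nat) (Q : nat -> R -> Prop) :
  (forall k K K', K <= K' -> Q k K -> Q k K') ->
  (forall k, (k < m)%N -> exists K, Q k K) ->
  exists2 K, 0 <= K & forall k, (k < m)%N -> Q k K.
Proof.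
move=> mon; elim: m => [|m ih] h; first by exists 0.
have [k km|K K0 QK] := ih; first by apply: h; rewrite ltnS ltnW.
have [K' QK'] := h m (ltnSn m).
exists (Num.max K K') => [|k]; first by rewrite le_max K0.
rewrite ltnS leq_eqVlt => /predU1P[->|km].
  by apply: mon QK'; rewrite le_max lexx orbT.
by apply: mon (QK _ km); rewrite le_max lexx.
Qed.

End BoundedContinuous.

Section Continuous01.
Context {R : realType}.
Local Notation mu := (@lebesgue_measure R).
Implicit Types f g : R -> R.

Lemma within_continuousM f g (A : set R) : {within A, continuous f} ->
  {within A, continuous g} -> {within A, continuous (fun x => f x * g x)}.
Proof. by move=> cf cg x; apply: cvgM; [exact: cf|exact: cg]. Qed.

Lemma within_continuousZ c f (A : set R) : {within A, continuous f} ->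
  {within A, continuous (fun x => c * f x)}.
Proof. by move=> cf x; apply: cvgM; [exact: cvg_cst|exact: cf]. Qed.

Lemma within_continuous_sum (I : eqType) (s : seq I) (f : I -> R -> R) (A : set R) :
  (forall i, i \in s -> {within A, continuous (f i)}) ->
  {within A, continuous (fun x => \sum_(i <- s) f i x)}.
Proof.
elim: s => [_|i s ih cf] x.
  by under eq_fun do rewrite big_nil; exact: cvg_cst.
under eq_fun do rewrite big_cons; apply: cvgD; first exact: (cf i (mem_head _ _)).
by apply: ih => k ks; apply: cf; rewrite inE ks orbT.
Qed.

Lemma within_continuous_eq01 f g : (forall x, 0 <= x <= 1 -> f x = g x) ->
  {within `[0, 1], continuous f} -> {within `[0, 1], continuous g}.
Proof.
move=> fg; apply: subspace_eq_continuous => x.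
by rewrite inE/= in_itv/= => /fg.
Qed.

Lemma integrable01 f : {within `[0, 1], continuous f} ->
  mu.-integrable `[0, 1] (EFin \o f).
Proof. by move=> cf; apply: continuous_compact_integrable => //; exact: segment_compact. Qed.

End Continuous01.

Section WaveletBounds.
Context {R : realType} (B : cdv_data R) (hB : cdv_basis B).
Local Notation M := (cdv_M B).
Local Notation l0 := (cdv_l0 B).

Lemma cdv_phi_bounded : bounded_continuous (cdv_phi B).
Proof.
apply: compact_support_bounded (cdv_phi_supp hB).
have := cdv_phi_continuous hB; have := cdv_phi_derivable hB.
(* For A = 0 the continuity axiom is about [cdv_phi] itself; otherwise [cdv_phi] is its own
   derivative of order 0 and is differentiable. *)
case: (cdv_A B) => [//|A d _] x.
by apply: differentiable_continuous; apply/derivable1_diffP; exact: (d 0%N).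
Qed.

Lemma continuous_affine (a b : R) : continuous (fun x : R => a * x + b).
Proof.
move=> x; apply: cvgD; last exact: cvg_cst.
by apply: cvgM; [exact: cvg_cst|exact: cvg_id].
Qed.

(** Continuity and boundedness pass from [cdv_phi] to [cdv_psi] through the finite refinement
    sum. *)
Lemma cdv_psi_bounded : bounded_continuous (cdv_psi B).
Proof.
rewrite (_ : cdv_psi B = fun x => Num.sqrt 2 * \sum_(n < 2 * M)
      ((-1) ^+ n * cdv_h B (2 * M - 1 - n)%N
        * cdv_phi B (2 * x - (n%:R - M%:R + 1)))); last first.
  by apply/funext => x; exact: cdv_psi_refinement hB x.
apply: bounded_continuousZ; apply: bounded_continuous_sum => n.
apply: bounded_continuousZ.
exact: (bounded_continuous_comp (@continuous_affine 2 _) cdv_phi_bounded).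
Qed.

Lemma edge_raw_bounded (phi : R -> R) i : bounded_continuous phi ->
  bounded_continuous (edge_raw M phi i).
Proof.
move=> bphi; apply: bounded_continuous_sum => n; apply: bounded_continuousZ.
have := bounded_continuous_comp (@continuous_affine 1 (n%:R - M%:R + 1)) bphi.
congr bounded_continuous; apply/funext => x /=; congr phi; ring.
Qed.

(** The axioms prescribe the boundary functions for y >= 0 only, so they are matched there with a
    combination [g] that is continuous on the whole line. *)
Lemma edge_scaling_bounded (phi : R -> R) e k : bounded_continuous phi ->
  edge_scaling M phi e -> (k < M)%N ->
  exists2 g, bounded_continuous g & forall y, 0 <= y -> e k y = g y.
Proof.
move=> bphi edge kM; have [a ea] := edge k kM.
exists (fun y => \sum_(i < M | (M <= k + i + 1)%N) a i * edge_raw M phi i y) => //.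
by apply: bounded_continuous_sum => i; apply: bounded_continuousZ; exact: edge_raw_bounded.
Qed.

Lemma reflected_bounded (phi : R -> R) : bounded_continuous phi ->
  bounded_continuous (reflected phi).
Proof.
move=> /(bounded_continuous_comp (@continuous_affine (-1) 1)).
congr bounded_continuous; apply/funext => x; rewrite /reflected/=; congr phi; ring.
Qed.

Lemma cdv_right_index j k : (k < 2 ^ j)%N -> ~~ (k < 2 ^ j - M)%N ->
  (2 ^ j - 1 - k < M)%N.
Proof. by move: (2 ^ j)%N => N; lia. Qed.

Lemma pow2_ge0 j : 0 <= 2 ^+ j :> R. Proof. exact: exprn_ge0. Qed.

Lemma rescale_right j (x : R) : x <= 1 -> 0 <= 2 ^+ j * (1 - x).
Proof. by move=> x1; rewrite mulr_ge0 ?pow2_ge0// subr_ge0. Qed.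

Lemma cdv_fun_bound (g : R -> R) (gL gR : nat -> R -> R) (K : R) j k x :
  (forall y, `|g y| <= K) ->
  (forall i, (i < M)%N -> forall y, 0 <= y -> `|gL i y| <= K /\ `|gR i y| <= K) ->
  (k < 2 ^ j)%N -> 0 <= x <= 1 ->
  `|cdv_fun M g gL gR j k x| <= K * Num.sqrt (2 ^+ j).
Proof.
move=> gK eK kj /andP[x0 x1]; rewrite /cdv_fun normrM ger0_norm ?sqrtr_ge0// mulrC.
rewrite ler_wpM2r ?sqrtr_ge0//; case: ifPn => [kM|_].
  by apply: (eK k kM _ _).1; rewrite mulr_ge0 ?pow2_ge0.
case: ifPn => [_//|kM].
by apply: (eK _ (cdv_right_index kj kM) _ _).2; exact: rescale_right.
Qed.

Lemma cdv_scaling_within_continuous j k : (k < 2 ^ j)%N ->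
  {within `[0, 1], continuous (cdv_scaling B j k)}.
Proof.
move=> kj; rewrite /cdv_scaling /cdv_fun; apply: within_continuousZ.
have bphi := cdv_phi_bounded.
case: (boolP (k < M)%N) => [kM|_].
  have [g bg gE] := edge_scaling_bounded bphi (cdv_phiL_edge hB) kM.
  apply: (@within_continuous_eq01 _ (fun x => g (2 ^+ j * x + 0))).
    by move=> x /andP[x0 _]; rewrite addr0 gE// mulr_ge0 ?pow2_ge0.
  apply: continuous_subspaceT.
  exact: (bounded_continuous_comp (@continuous_affine (2 ^+ j) 0) bg).1.
case: (boolP (k < 2 ^ j - M)%N) => [_|kM].
  apply: continuous_subspaceT.
  exact: (bounded_continuous_comp (@continuous_affine (2 ^+ j) (- k%:R)) bphi).1.
have [g bg gE] := edge_scaling_bounded (reflected_bounded bphi) (cdv_phiR_edge hB)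
  (cdv_right_index kj kM).
apply: (@within_continuous_eq01 _ (fun x => g (- 2 ^+ j * x + 2 ^+ j))).
  move=> x /andP[_ x1]; rewrite gE ?rescale_right//; congr g; ring.
apply: continuous_subspaceT.
exact: (bounded_continuous_comp (@continuous_affine (- 2 ^+ j) (2 ^+ j)) bg).1.
Qed.

Lemma cdv_scaling_bound : exists2 K, 0 <= K & forall j k x, (k < 2 ^ j)%N ->
  0 <= x <= 1 -> `|cdv_scaling B j k x| <= K * Num.sqrt (2 ^+ j).
Proof.
have bphi := cdv_phi_bounded; have [_ [K1 hK1]] := bphi.
have [|k kM|K2 K20 hK2] := @uniform_bound R M (fun k K => forall y, 0 <= y ->
  `|cdv_phiL B k y| <= K /\ `|cdv_phiR B k y| <= K).
- move=> k K K' KK' h y y0; have [h1 h2] := h y y0.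
  by split; [exact: le_trans h1 KK'|exact: le_trans h2 KK'].
- have [g [_ [K gK]] gE] := edge_scaling_bounded bphi (cdv_phiL_edge hB) kM.
  have [g' [_ [K' gK']] gE'] := edge_scaling_bounded (reflected_bounded bphi)
    (cdv_phiR_edge hB) kM.
  exists (Num.max K K') => y y0; rewrite gE// gE'//.
  by rewrite !le_max gK gK' orbT.
exists (Num.max K1 K2) => [|j k x kj x01]; first by rewrite le_max K20 orbT.
apply: cdv_fun_bound => //; first by move=> y; rewrite le_max hK1.
by move=> i iM y y0; have [h1 h2] := hK2 i iM y y0; rewrite !le_max h1 h2 !orbT.
Qed.

(** Membership in the next scaling space replaces the missing formula for the edge wavelets: on
    [0, 1] they are finite combinations of continuous functions. *)
Lemma cdv_detail_within_continuous j k : (l0 < j)%N -> (k < 2 ^ j)%N ->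
  {within `[0, 1], continuous (cdv_detail B j k)}.
Proof.
move=> l0j kj; have [c cE] := cdv_detail_nested hB l0j kj.
apply: (@within_continuous_eq01 _ (fun x => \sum_(i < 2 ^ j.+1) c i * cdv_scaling B j.+1 i x)).
  by move=> x x01; rewrite cE.
by apply: within_continuous_sum => i _; apply: within_continuousZ;
  exact: cdv_scaling_within_continuous.
Qed.

(* At the coarsest scale, [cdv_coarse] makes the rescaled interval [0, 2^j]
   contain the support [0, 2M - 1] of the edge wavelets. *)
Lemma cdv_detail_bound : exists2 K, 0 <= K & forall j k x, (k < 2 ^ j)%N ->
  0 <= x <= 1 -> `|cdv_detail B j k x| <= K * Num.sqrt (2 ^+ j).
Proof.
have [_ [K1 hK1]] := cdv_psi_bounded.
have coarse := cdv_coarse hB; set j := l0.+1 in coarse.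
have s1 : 1 <= Num.sqrt (2 ^+ j) :> R.
  by rewrite -[leLHS]sqrtr1 ler_sqrt ?exprn_gt0// exprn_ege1// ler1n.
have p0 : 2 ^+ j != 0 :> R by rewrite expf_neq0// pnatr_eq0.
have ypos (y : R) : 0 <= y -> y <= 2 ^+ j -> 0 <= y / 2 ^+ j <= 1.
  move=> y0 y1; rewrite divr_ge0 ?pow2_ge0//= ler_pdivrMr ?exprn_gt0//.
  by rewrite mul1r.
have ybig (y : R) : ~~ (y <= 2 ^+ j) -> (2 * M)%:R - 1 < y.
  rewrite -ltNge; apply: le_lt_trans.
  rewrite (@le_trans _ _ ((2 * M)%:R))// ?gerBl//.
  by rewrite -natrX ler_nat.
have [|k kM|K2 K20 hK2] := @uniform_bound R M (fun k K => forall y, 0 <= y ->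
  `|cdv_psiL B k y| <= K /\ `|cdv_psiR B k y| <= K).
- move=> k K K' KK' h y y0; have [h1 h2] := h y y0.
  by split; [exact: le_trans h1 KK'|exact: le_trans h2 KK'].
- have kj : (k < 2 ^ j)%N by lia.
  (* [k'] is the index whose function is the right boundary function number [k]; [cdv_coarse] keeps
     it clear of the left boundary indices. *)
  pose k' := (2 ^ j - 1 - k)%N; have k'j : (k' < 2 ^ j)%N by rewrite /k'; lia.
  have k'k : (2 ^ j - 1 - k' = k)%N by rewrite /k'; lia.
  have nk'M : (k' < M)%N = false by rewrite /k'; lia.
  have nk'M' : (k' < 2 ^ j - M)%N = false by rewrite /k'; lia.
  have [KL KL0 hKL] := bounded_within_segment (cdv_detail_within_continuous (ltnSn l0) kj).
  have [KR KR0 hKR] := bounded_within_segment (cdv_detail_within_continuous (ltnSn l0) k'j).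
  exists (Num.max KL KR) => y y0; rewrite !le_max.
  have [yj|/ybig yj] := boolP (y <= 2 ^+ j); last first.
    by rewrite (cdv_psiL_supp hB kM yj) (cdv_psiR_supp hB kM yj) normr0 KL0.
  have /andP[z0 z1] := ypos y y0 yj; split.
    have := hKL _ (ypos y y0 yj); rewrite /cdv_detail /cdv_fun kM mulrCA divff// mulr1.
    move=> h; rewrite (le_trans _ h)// normrM ger0_norm ?sqrtr_ge0//.
    by rewrite ler_peMl.
  have z01 : 0 <= 1 - y / 2 ^+ j <= 1 by rewrite subr_ge0 z1 gerBl z0.
  have := hKR _ z01; rewrite /cdv_detail /cdv_fun nk'M nk'M' k'k.
  rewrite subKr mulrCA divff// mulr1 => h.
  apply/orP; right; rewrite (le_trans _ h)// normrM ger0_norm ?sqrtr_ge0//.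
  by rewrite ler_peMl.
exists (Num.max K1 K2) => [|i k x kj x01]; first by rewrite le_max K20 orbT.
apply: cdv_fun_bound => //; first by move=> y; rewrite le_max hK1.
by move=> i' iM y y0; have [h1 h2] := hK2 i' iM y y0; rewrite !le_max h1 h2 !orbT.
Qed.

Lemma wav_within_continuous l k : (l0 <= l)%N -> (k < wav_size B l)%N ->
  {within `[0, 1], continuous (wav B l k)}.
Proof.
rewrite /wav_size /wav leq_eqVlt eq_sym; case: eqP => [_ _|_ /= l0l].
  exact: cdv_scaling_within_continuous.
exact: cdv_detail_within_continuous.
Qed.

Lemma wav_bound : exists2 K, 0 <= K & forall l k x, (k < wav_size B l)%N ->
  0 <= x <= 1 -> `|wav B l k x| <= K * Num.sqrt (2 ^+ l).
Proof.
have [K1 K10 hK1] := cdv_scaling_bound; have [K2 K20 hK2] := cdv_detail_bound.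
(* The factor sqrt 2 pays for level l0, which holds father wavelets at scale 2^(l0 + 1). *)
exists (Num.max (K1 * Num.sqrt 2) K2) => [|l k x]; first by rewrite le_max K20 orbT.
rewrite /wav /wav_size; case: eqP => [->|_] kl x01.
  rewrite (le_trans (hK1 _ _ _ kl x01))// exprS sqrtrM// mulrA.
  by rewrite ler_wpM2r ?sqrtr_ge0// le_max lexx.
rewrite (le_trans (hK2 _ _ _ kl x01))//.
by rewrite ler_wpM2r ?sqrtr_ge0// le_max lexx orbT.
Qed.

End WaveletBounds.

(** * The wavelet kernel *)

Section WaveletKernel.
Context {R : realType} (B : cdv_data R) (hB : cdv_basis B).
Context (cA : nat) (hcA : overlap_bound B cA).
Local Notation mu := (@lebesgue_measure R).
Local Notation l0 := (cdv_l0 B).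

(** A wavelet that does not vanish at x has x in its closed support, so at most [cA] terms of the
    level can be positive. *)
Lemma overlap_sum_le l x (F : nat -> R) T : (l0 <= l)%N -> 0 <= x <= 1 -> 0 <= T ->
  (forall k, (k < wav_size B l)%N -> F k <= T) ->
  (forall k, (k < wav_size B l)%N -> wav B l k x = 0 -> F k <= 0) ->
  \sum_(k < wav_size B l) F k <= cA%:R * T.
Proof.
move=> l0l x01 T0 FT F0.
pose S := [set k : 'I_(wav_size B l) | `[< wav_support B l k x >]].
apply: (@le_trans _ _ (\sum_(k in S) T)); last first.
  by rewrite sumr_const -[leLHS]mulr_natl ler_wpM2r// ler_nat hcA.
rewrite [leRHS]big_mkcond/=; apply: ler_sum => k _.
case: ifPn => [_|kS]; first exact: FT.
apply: F0 => //; apply: contraNeq kS => wk0; rewrite inE /S/=; apply/asboolP.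
by apply: subset_closure; split.
Qed.

Lemma inner01_suml (I : eqType) (s : seq I) (F : I -> R -> R) (g : R -> R) (c : I -> R) :
  {within `[0, 1], continuous g} ->
  (forall i, i \in s -> {within `[0, 1], continuous (F i)}) ->
  inner01 (fun x => \sum_(i <- s) c i * F i x) g = \sum_(i <- s) c i * inner01 (F i) g.
Proof.
move=> cg cF; rewrite /inner01.
have cFg i : i \in s -> {within `[0, 1], continuous (fun x => F i x * g x)}.
  by move=> si; apply: within_continuousM => //; exact: cF.
have [|_ E] := @Rintegral_sum _ _ _ mu _ s `[0, 1] (fun i x => c i * (F i x * g x))
  (measurable_itv _).
  by move=> i si; apply: integrable01; apply: within_continuousZ; exact: cFg.
transitivity (\int[mu]_(x in `[0, 1]) (\sum_(i <- s) c i * (F i x * g x))).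
  apply: eq_Rintegral => x _; rewrite mulr_suml.
  by apply: eq_bigr => i _; rewrite mulrA.
rewrite E; apply: eq_big_seq => i si; rewrite RintegralZl//.
by apply: integrable01; exact: cFg.
Qed.

Lemma inner01C (f g : R -> R) : inner01 f g = inner01 g f.
Proof. by apply: eq_Rintegral => x _; rewrite mulrC. Qed.

(** The levels are l0, ..., L - 1: the bound is exclusive, and the estimator with top level [L]
    corresponds to [L.+1]. *)
Definition wav_expansion (L : nat) (c : nat -> nat -> R) (x : R) : R :=
  \sum_(l0 <= l < L) \sum_(k < wav_size B l) c l k * wav B l k x.

Lemma wav_level_within_continuous l (c : nat -> R) : (l0 <= l)%N ->
  {within `[0, 1], continuous (fun x => \sum_(k < wav_size B l) c k * wav B l k x)}.
Proof.
move=> l0l; apply: within_continuous_sum => k _; apply: within_continuousZ.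
exact: wav_within_continuous.
Qed.

Lemma wav_expansion_within_continuous L c :
  {within `[0, 1], continuous (wav_expansion L c)}.
Proof.
apply: within_continuous_sum => l; rewrite mem_index_iota => /andP[l0l _].
exact: wav_level_within_continuous.
Qed.

Lemma inner01_expansion L c (g : R -> R) : {within `[0, 1], continuous g} ->
  inner01 (wav_expansion L c) g =
  \sum_(l0 <= l < L) \sum_(k < wav_size B l) c l k * inner01 (wav B l k) g.
Proof.
move=> cg; transitivity (inner01 (fun x => \sum_(l0 <= l < L) 1 *
    \sum_(k < wav_size B l) c l k * wav B l k x) g).
  apply: eq_Rintegral => x _; congr (_ * _).
  by apply: eq_bigr => l _; rewrite mul1r.
rewrite (@inner01_suml _ _ (fun l x => \sum_(k < wav_size B l) c l k * wav B l k x)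
  g (fun=> 1))//; last first.
  move=> l; rewrite mem_index_iota => /andP[l0l _].
  exact: wav_level_within_continuous l0l.
apply: eq_big_seq => l; rewrite mem_index_iota => /andP[l0l _].
rewrite mul1r inner01_suml// => k _; exact: wav_within_continuous.
Qed.

Lemma inner01_expansion_wav L c l k : (l0 <= l < L)%N -> (k < wav_size B l)%N ->
  inner01 (wav B l k) (wav_expansion L c) = c l k.
Proof.
move=> /andP[l0l lL] kl; rewrite inner01C inner01_expansion; last first.
  exact: wav_within_continuous.
rewrite (big_rem l)/=; last by rewrite mem_index_iota l0l.
rewrite [X in _ + X]big1_seq ?addr0; last first.
  move=> l' /=; rewrite mem_rem_uniq ?iota_uniq// inE mem_index_iota => /and3P[l'l l0l' _].
  rewrite big1// => k' _.
  by rewrite (wav_orthonormal hB)// (negbTE l'l) mulr0.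
rewrite (bigD1 (Ordinal kl))//= big1 ?addr0 => [|k' k'k].
  by rewrite (wav_orthonormal hB)// !eqxx mulr1.
rewrite (wav_orthonormal hB)// eqxx/= (_ : _ == k = false) ?mulr0//.
by apply: contraNF k'k => /eqP kk'; apply/eqP/val_inj.
Qed.

(** The reproducing kernel of the span of the levels below L, with one argument frozen at x0:
    testing f against it evaluates the truncated expansion of f at x0. *)
Definition wav_kernel L x0 : R -> R := wav_expansion L (fun l k => wav B l k x0).

Lemma inner01_wav_kernel L x0 (f : R -> R) : {within `[0, 1], continuous f} ->
  inner01 f (wav_kernel L x0) = wav_expansion L (wav_coef B f) x0.
Proof.
move=> cf; rewrite inner01C inner01_expansion//; apply: eq_bigr => l _.
by apply: eq_bigr => k _; rewrite /wav_coef inner01C mulrC.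
Qed.

Lemma geometric_pow2_le L : \sum_(l0 <= l < L) 2 ^+ l <= 2 ^+ L :> R.
Proof.
elim: L => [|L ih]; first by rewrite big_geq.
have [L0|L0] := leqP l0 L; last by rewrite big_geq ?exprn_ge0.
rewrite big_nat_recr//= exprS; have := exprn_ge0 L (ler0n R 2); lra.
Qed.

(** The squared norm is the kernel on the diagonal, that is, the sum of the squares of
    [wav B l k x0]. A level has at most [cA] nonzero terms, each of order 2^l, and the levels add up
    geometrically. The summand 1 makes the constant positive. *)
Lemma wav_kernel_sqr_norm : exists2 C, 0 < C & forall L x0, 0 <= x0 <= 1 ->
  \int[mu]_(x in `[0, 1]) (wav_kernel L x0 x ^+ 2) <= C * 2 ^+ L.
Proof.
have [K K0 hK] := wav_bound hB; exists (cA%:R * K ^+ 2 + 1).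
  by rewrite ltr_wpDl// mulr_ge0// sqr_ge0.
move=> L x0 x01.
have cK := @wav_expansion_within_continuous L (fun l k => wav B l k x0).
rewrite (_ : \int[mu]_(x in _) _ = inner01 (wav_kernel L x0) (wav_kernel L x0)); last first.
  by apply: eq_Rintegral => x _; rewrite expr2.
rewrite {1}/wav_kernel inner01_expansion//.
apply: (@le_trans _ _ (\sum_(l0 <= l < L) (cA%:R * K ^+ 2) * 2 ^+ l)).
  apply: ler_sum_nat => l /andP[l0l lL].
  rewrite -mulrA; under eq_bigr do rewrite inner01_expansion_wav// ?l0l//.
  have wK k : (k < wav_size B l)%N -> wav B l k x0 * wav B l k x0 <= K ^+ 2 * 2 ^+ l.
    move=> kl; rewrite -expr2 -real_normK ?num_real//.
    rewrite -[2 ^+ l]sqr_sqrtr ?exprn_ge0// -exprMn ler_pXn2r ?nnegrE//; last first.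
      by rewrite mulr_ge0 ?sqrtr_ge0.
    exact: hK.
  apply: (overlap_sum_le (F := fun k => wav B l k x0 * wav B l k x0)
    l0l x01) => // [|k kl ->]; last by rewrite mul0r.
  by rewrite mulr_ge0 ?sqr_ge0 ?exprn_ge0.
rewrite -mulr_sumr; apply: (@le_trans _ _ ((cA%:R * K ^+ 2) * 2 ^+ L)).
  by rewrite ler_wpM2l ?geometric_pow2_le// mulr_ge0 ?sqr_ge0.
by rewrite ler_wpM2r ?exprn_ge0// lerDl.
Qed.

End WaveletKernel.

(** * Wavelet expansions of Besov functions *)

Section BesovBall.
Context {R : realType} (B : cdv_data R) (hB : cdv_basis B).
Context (cA : nat) (hcA : overlap_bound B cA).
Local Notation mu := (@lebesgue_measure R).
Local Notation l0 := (cdv_l0 B).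

Lemma coef_le_lp_norm (p : \bar R) (s : nat) (v : nat -> R) k :
  (1%:E <= p)%E -> (k < s)%N -> `|v k| <= lp_norm p s v.
Proof.
case: p => [p| |]// p1 ks.
  have p0 : 0 < p by rewrite lee_fin in p1; exact: lt_le_trans p1.
  rewrite /lp_norm; have -> : `|v k| = (`|v k| `^ p) `^ p^-1.
    by rewrite -powRrM divff ?gt_eqF// powRr1.
  apply: ge0_ler_powR; rewrite ?invr_ge0 ?(ltW p0)// ?nnegrE ?powR_ge0//.
    by apply: sumr_ge0 => i _; rewrite powR_ge0.
  by rewrite (bigD1 (Ordinal ks))//= lerDl sumr_ge0// => i _; rewrite powR_ge0.
by rewrite /lp_norm; apply: (le_bigmax_cond _ (fun i : 'I_s => `|v i|) (j := Ordinal ks)).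
Qed.

Lemma lp_norm_ge0 (p : \bar R) s v : 0 <= lp_norm p s v :> R.
Proof.
case: p => [p| |]/=; first by rewrite powR_ge0.
- by elim/big_ind: _ => // x y x0 y0; rewrite le_max x0.
- by elim/big_ind: _ => // x y x0 y0; rewrite le_max x0.
Qed.

Lemma besov_term_ge0 alpha p f l : 0 <= besov_term B alpha p f l.
Proof. by rewrite mulr_ge0 ?powR_ge0// lp_norm_ge0. Qed.

Lemma besov_term_le alpha p q f r l : (1%:E <= q)%E -> (l0 <= l)%N ->
  besov_ball B alpha p q r f -> besov_term B alpha p f l <= r.
Proof.
move=> q1 l0l [_]; case: q q1 => [q| |]// q1; rewrite /besov_norm.
  have q0 : 0 < q by rewrite lee_fin in q1; exact: lt_le_trans q1.
  rewrite -lee_fin; apply: le_trans.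
  set t := besov_term B alpha p f l; have t0 : 0 <= t by exact: besov_term_ge0.
  have -> : t%:E = (((t `^ q)%:E) `^ q^-1)%E.
    by rewrite poweR_EFin -powRrM divff ?gt_eqF// powRr1.
  have f0 i : (0 <= (besov_term B alpha p f i `^ q)%:E)%E by rewrite lee_fin powR_ge0.
  apply: gt0_ler_poweR.
  - by rewrite invr_ge0 ltW.
  - by rewrite in_itv/= leey andbT; exact: f0.
  - by rewrite in_itv/= leey andbT; apply: nneseries_ge0 => i _ _; exact: f0.
  have := @nneseries_lim_ge _ (fun i => (besov_term B alpha p f i `^ q)%:E) xpredT
    l0 l.+1 (fun i _ _ => f0 i).
  by apply: le_trans; rewrite big_nat_recr//= leeDr// sume_ge0.
by rewrite -lee_fin; apply: le_trans; apply: ereal_sup_ubound; exists l.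
Qed.

(** The ball embeds into a Hoelder-Zygmund ball of smoothness nu: the exponent alpha + 1/2 - 1/p of
    the weight is nu + 1/2, and the l_p norm dominates each coefficient. *)
Lemma besov_coef_le alpha nu p q f r l k :
  (2%:E <= p)%E -> (1%:E <= q)%E -> nu = alpha - inv_exponent p ->
  besov_ball B alpha p q r f -> (l0 <= l)%N -> (k < wav_size B l)%N ->
  `|wav_coef B f l k| <= r * 2 `^ (- (l%:R * (nu + 2^-1))).
Proof.
move=> p2 q1 -> fB l0l kl; have := besov_term_le q1 l0l fB.
have p1 : (1%:E <= p)%E by apply: le_trans p2; rewrite lee_fin ler1n.
have := coef_le_lp_norm (wav_coef B f l) p1 kl.
rewrite /besov_term (_ : alpha + _ - _ = alpha - inv_exponent p + 2^-1); last by ring.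
set e := l%:R * _; move=> h1 h2; rewrite powRN ler_pdivlMr ?powR_gt0// mulrC.
by apply: le_trans h2; rewrite ler_wpM2l ?powR_ge0.
Qed.

Lemma powR2_half l : Num.sqrt (2 ^+ l) = 2 `^ (l%:R / 2) :> R.
Proof. by rewrite -powR12_sqrt ?exprn_ge0// -powR_mulrn// -powRrM. Qed.

(** Coefficient decay times wavelet size. Once e is weakened to 2, the same identity turns the
    clipping error e^(- t^2 / 4) 2^(L / 2) into the rate of the truncation bias. *)
Lemma powR2_level nu l :
  2 `^ (- (l%:R * (nu + 2^-1))) * Num.sqrt (2 ^+ l) = (2 `^ (- nu)) ^+ l :> R.
Proof.
rewrite powR2_half -powRD; last by rewrite pnatr_eq0 implybT.
by rewrite -powR_mulrn ?powR_ge0// -powRrM; congr (_ `^ _); field.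
Qed.

Lemma geometric_tail_le (rho : R) (L L' : nat) : 0 <= rho < 1 -> (L <= L')%N ->
  \sum_(L <= l < L') rho ^+ l <= rho ^+ L / (1 - rho).
Proof.
move=> /andP[r0 r1] LL'; have d0 : 0 < 1 - rho by rewrite subr_gt0.
suff -> : \sum_(L <= l < L') rho ^+ l = (rho ^+ L - rho ^+ L') / (1 - rho).
  by rewrite ler_pM2r ?invr_gt0// gerBl exprn_ge0.
elim: L' LL' => [|L' ih]; first by rewrite leqn0 => /eqP->; rewrite big_geq// subrr mul0r.
rewrite leq_eqVlt => /predU1P[->|LL']; first by rewrite big_geq// subrr mul0r.
rewrite big_nat_recr//= ih// exprS; field.
by rewrite subr_eq0 eq_sym lt_eqF.
Qed.

Lemma wav_level_le : exists2 K, 0 <= K & forall nu r l (c : nat -> R) x,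
  0 <= r -> (l0 <= l)%N ->
  (forall k, (k < wav_size B l)%N -> `|c k| <= r * 2 `^ (- (l%:R * (nu + 2^-1)))) ->
  0 <= x <= 1 ->
  `|\sum_(k < wav_size B l) c k * wav B l k x| <= K * r * (2 `^ (- nu)) ^+ l.
Proof.
have [K K0 hK] := wav_bound hB; exists (cA%:R * K) => [|nu r l c x r0 l0l cl x01].
  by rewrite mulr_ge0.
rewrite (le_trans (ler_norm_sum _ _ _))//.
rewrite -!mulrA.
apply: (overlap_sum_le hcA (F := fun k => `|c k * wav B l k x|) l0l x01).
- by rewrite !mulr_ge0// exprn_ge0// powR_ge0.
- move=> k kl; rewrite normrM; apply: (le_trans (ler_pM _ _ (cl k kl) (hK _ _ _ kl x01))) => //.
  by rewrite mulrACA powR2_level le_eqVlt; apply/orP; left; apply/eqP; ring.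
- by move=> k kl ->; rewrite mulr0 normr0.
Qed.

(* The expansion converges geometrically on [0, 1], and in L2 to [f]; if its
   limit at [x0] were off, the L2 error would stay bounded below on a ball
   around [x0]. *)
Lemma wav_expansion_error : exists2 K, 0 <= K & forall nu r (f : R -> R) x0 L,
  0 < nu -> 0 <= r -> {within `[0, 1], continuous f} ->
  (forall l k, (l0 <= l)%N -> (k < wav_size B l)%N ->
     `|wav_coef B f l k| <= r * 2 `^ (- (l%:R * (nu + 2^-1)))) ->
  0 < x0 < 1 -> (l0 <= L)%N ->
  `|wav_expansion B L (wav_coef B f) x0 - f x0| <=
    K * r * (2 `^ (- nu)) ^+ L / (1 - 2 `^ (- nu)).
Proof.
have [K K0 hK] := wav_level_le; exists K => // nu r f x0 L nu0 r0 cf fc x01 l0L.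
set rho := 2 `^ (- nu).
have rho0 : 0 <= rho by exact: powR_ge0.
have rho1 : rho < 1.
  rewrite /rho powRN invf_lt1 ?powR_gt0//.
  have := gt0_ltr_powR nu0 (x := 1) (y := 2); rewrite powR1 !nnegrE.
  by apply; rewrite ?ltr1n.
set tail := K * r * _ / _; pose S n := wav_expansion B n (wav_coef B f).
have S_tail L' x : (L <= L')%N -> 0 <= x <= 1 -> `|S L' x - S L x| <= tail.
  move=> LL' xx; rewrite /S /wav_expansion (big_cat_nat l0L LL')/= addrAC subrr add0r.
  rewrite (le_trans (ler_norm_sum _ _ _))//.
  apply: (@le_trans _ _ (\sum_(L <= l < L') K * r * rho ^+ l)).
    apply: ler_sum_nat => l /andP[Ll _]; have l0l := leq_trans l0L Ll.
    by apply: hK => // k kl; exact: fc.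
  rewrite -mulr_sumr /tail -[leRHS]mulrA ler_wpM2l ?mulr_ge0//.
  by apply: geometric_tail_le; rewrite ?rho0.
rewrite distrC leNgt; apply/negP => gap.
pose h x := `|f x - S L x|.
have cS n : {within `[0, 1], continuous (S n)} by exact: wav_expansion_within_continuous.
have cSf n : {within `[0, 1], continuous (fun x => f x - S n x)}.
  by move=> x; apply: cvgB; [exact: cf|exact: cS].
(* Half the excess over the bound. Near the interior point x0, |f - S L| stays above tail + e, hence
   |f - S n| exceeds e for every n >= L. *)
pose e := (h x0 - tail) / 2.
have e0 : 0 < e by rewrite divr_gt0// subr_gt0.
have x0in : x0 \in `]0, 1[%R by rewrite in_itv.
have ch : {for x0, continuous h}.
  have [/(_ _ x0in) c _ _] := (continuous_within_itvP _ (@ltr01 R)).1 (cSf L).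
  exact: (continuous_comp c (@norm_continuous _ R _)).
have [d d0 hd] : exists2 d, 0 < d & forall x, ball x0 d x -> 0 <= x <= 1 /\ tail + e < h x.
  have n1 : \forall x \near x0, 0 <= x <= 1.
    have := near_in_itvoo x0in; apply: filterS => x; rewrite in_itv/= => /andP[a b].
    by rewrite !ltW.
  have n2 : \forall x \near x0, tail + e < h x.
    apply: (cvgr_gt _ ch); rewrite /e.
    have : tail < h x0 by []. lra.
  have [d /= d0 hd] := (nbhs_ballP _ _).1 (filterI n1 n2).
  by exists d => // x /hd.
have mf : measurable_fun (`[0, 1] : set R) f.
  exact: subspace_continuous_measurable_fun.
have if2 : mu.-integrable `[0, 1] (fun x : R => (f x ^+ 2)%:E).
  by apply: (integrable01 (f := fun x => f x ^+ 2)); exact: within_continuousM.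
(* The length [d * 2] of the ball times [e ^+ 2], a value that the squared L2 error cannot get
   below. *)
have /cvgrPdist_lt/(_ (d * 2 * e ^+ 2)) := wav_complete hB mf if2.
have de0 : 0 < d * 2 * e ^+ 2 by rewrite mulr_gt0 ?exprn_gt0// mulr_gt0.
move=> /(_ de0) [N _ /(_ (maxn N L) (leq_maxl _ _))].
rewrite sub0r normrN; apply/negP; rewrite -leNgt.
set n := maxn N L; have Ln : (L <= n)%N by exact: leq_maxr.
rewrite (le_trans _ (ler_norm _))//.
have iSf : mu.-integrable `[0, 1] (EFin \o (fun x => (f x - S n x) ^+ 2)).
  by apply: integrable01; exact: within_continuousM.
rewrite -lee_fin (_ : (\int[mu]_(x in _) _)%:E =
    \int[mu]_(x in `[0%R, 1%R]) ((f x - S n x) ^+ 2)%:E)%E; last first.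
  by rewrite /Rintegral fineK// (integrable_fin_num _ iSf).
have mball : measurable (ball x0 d : set R) by exact: measurable_ball.
apply: (@le_trans _ _ (\int[mu]_(x in ball x0 d) ((f x - S n x) ^+ 2)%:E)%E); last first.
  apply: ge0_subset_integral => //.
  - by have /integrableP[] := iSf.
  - by move=> x _; rewrite lee_fin sqr_ge0.
  - by move=> x /hd[+ _]; rewrite /= in_itv.
apply: (@le_trans _ _ (\int[mu]_(x in ball x0 d) (cst (e ^+ 2)%:E x))%E).
  rewrite integral_cst//= (lebesgue_measure_ball x0 (ltW d0)) -EFinM lee_fin mulrC.
  by rewrite mulr_natr.
apply: ge0_le_integral => //.
- by move=> x _; rewrite lee_fin sqr_ge0.
- have /integrableP[m _] := iSf; apply: measurable_funS m => // x /hd[+ _].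
  by rewrite /= in_itv.
move=> x /hd[xx hx]; rewrite /= lee_fin -[leRHS]real_normK ?num_real//.
rewrite ler_pXn2r ?nnegrE ?(ltW e0)//.
have := S_tail n x Ln xx; have := ler_distD (S n x) (f x) (S L x).
rewrite /h in hx; lra.
Qed.

End BesovBall.

(** * Risk of the estimator *)

Section Weights.
Context {R : realType} (m : nat) (n : 'I_m -> nat) (eps : 'I_m -> R) (L : nat).
Hypotheses (n0 : forall j, (0 < n j)%N) (eps0 : forall j, 0 < eps j).

Let v j := raw_weight L (n j) (eps j).

Lemma raw_weight_gt0 j : 0 < v j.
Proof.
have nj : 0 < (n j)%:R :> R by rewrite ltr0n.
by rewrite /v /raw_weight lt_min !mulr_gt0 ?exprn_gt0.
Qed.

Lemma sum_raw_weight_ge0 : 0 <= \sum_j v j.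
Proof. by apply: sumr_ge0 => j _; rewrite ltW ?raw_weight_gt0. Qed.

Lemma weight_ge0 j : 0 <= weight L n eps j.
Proof. by rewrite divr_ge0 ?sum_raw_weight_ge0// ltW ?raw_weight_gt0. Qed.

Lemma sum_weight : 0 < \sum_j v j -> \sum_j weight L n eps j = 1.
Proof. by move=> v0; rewrite -mulr_suml divff// gt_eqF. Qed.

(* The weights are proportional to the inverse of the variance bound
   [2^(2L) / v_j] of the [j]-th transcript. *)
Lemma weighted_variance_le (c1 c2 : R) : 0 <= c1 -> 0 <= c2 -> 0 < \sum_j v j ->
  \sum_j weight L n eps j ^+ 2 * (c1 * 2 ^+ L / (n j)%:R +
    c2 * (2 ^+ L / ((n j)%:R * eps j)) ^+ 2) <=
  (c1 + c2) * (2 ^+ L) ^+ 2 / \sum_j v j.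
Proof.
move=> c10 c20 v0; set V := \sum_j v j in v0 *; set P2 : R := 2 ^+ L.
have P20 : 0 < P2 by rewrite exprn_gt0.
have -> : (c1 + c2) * P2 ^+ 2 / V = \sum_j (v j / V) ^+ 2 * ((c1 + c2) * (P2 ^+ 2 / v j)).
  transitivity (\sum_j v j * ((c1 + c2) * P2 ^+ 2 / V ^+ 2)).
    by rewrite -mulr_suml -/V; field; rewrite gt_eqF.
  apply: eq_bigr => j _; have vj := raw_weight_gt0 j.
  by field; rewrite !gt_eqF.
apply: ler_sum => j _; apply: ler_wpM2l; first exact: sqr_ge0.
have nj : 0 < (n j)%:R :> R by rewrite ltr0n.
have vj := raw_weight_gt0 j.
(* Each arm of the minimum serves one source of variance: n_j^2 eps_j^2 the privacy noise, n_j 2^L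
   the sampling variance 2^L / n_j. Both are then at most of order 2^(2L) / v_j. *)
have v1 : v j <= (n j)%:R ^+ 2 * eps j ^+ 2 by rewrite /v /raw_weight ge_min lexx.
have v2 : v j <= (n j)%:R * P2 by rewrite /v /raw_weight ge_min lexx orbT.
rewrite mulrDl; apply: lerD.
  rewrite -mulrA ler_wpM2l// ler_pdivrMr// mulrAC ler_pdivlMr// expr2 -mulrA.
  by rewrite ler_wpM2l 1?mulrC// ltW.
rewrite ler_wpM2l// expr_div_n exprMn ler_wpM2l ?sqr_ge0//.
by rewrite lef_pV2 ?posrE// mulr_gt0 ?exprn_gt0.
Qed.

End Weights.

Section Estimator.
Context {R : realType} (B : cdv_data R).

(** Exchanging the sums over wavelets and observations exposes the kernel and makes the estimate a
    sample mean. *)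
Lemma local_estimateE tau L s (z : 'I_s -> R * R) x0 :
  local_estimate B tau L z x0 =
  s%:R^-1 * \sum_(i < s) clip tau (z i).1 * wav_kernel B L.+1 x0 (z i).2.
Proof.
rewrite /local_estimate /local_coef /wav_kernel /wav_expansion.
under [in RHS]eq_bigr do rewrite mulr_sumr.
rewrite exchange_big/= mulr_sumr; apply: eq_bigr => l _.
under [in RHS]eq_bigr do rewrite mulr_sumr.
rewrite exchange_big/= mulr_sumr; apply: eq_bigr => k _.
rewrite -mulrA mulr_suml; congr (_ * _); apply: eq_bigr => i _.
by ring.
Qed.

Lemma noise_scaleE cA tau L s (eps : R) : noise_scale B cA tau L s eps =
  (2 * cA%:R * sup_norm (cdv_psi B) ^+ 2 * tau) * (2 ^+ L / (s%:R * eps)).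
Proof. by rewrite /noise_scale -mulrA. Qed.

End Estimator.

Section PointwiseRisk.
Context {R : realType} (B : cdv_data R) (hB : cdv_basis B).
Context (cA : nat) (hcA : overlap_bound B cA).
Local Notation mu := (@lebesgue_measure R).
Local Notation l0 := (cdv_l0 B).

(* [|g| <= (s + g^2 / s) / 2] with [s = 2^(L/2)]. *)
Lemma wav_kernel_norm (C : R) L x0 : 
  \int[mu]_(x in `[0, 1]) (wav_kernel B L.+1 x0 x ^+ 2) <= C * 2 ^+ L ->
  \int[mu]_(x in `[0, 1]) `|wav_kernel B L.+1 x0 x| <= (1 + C) / 2 * Num.sqrt (2 ^+ L).
Proof.
set g := wav_kernel B _ _ => gC; set s := Num.sqrt (2 ^+ L).
have s0 : 0 < s by rewrite sqrtr_gt0 exprn_gt0.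
have s2 : s ^+ 2 = 2 ^+ L by rewrite sqr_sqrtr// exprn_ge0.
have cg : {within `[0, 1], continuous g} by exact: wav_expansion_within_continuous.
have ig2 : mu.-integrable `[0, 1] (EFin \o (fun x => g x ^+ 2)).
  by apply: integrable01; exact: within_continuousM.
have ig2' : mu.-integrable `[0, 1] (EFin \o (fun x => (2 * s)^-1 * g x ^+ 2)).
  by apply: integrable01; apply: within_continuousZ; exact: within_continuousM.
have ic : mu.-integrable `[0, 1] (EFin \o (fun=> s / 2)).
  by apply: integrable01; apply: continuous_subspaceT; exact: cst_continuous.
apply: (@le_trans _ _ (\int[mu]_(x in `[0, 1]) (s / 2 + (2 * s)^-1 * g x ^+ 2))).
  apply: le_Rintegral => //.
  - exact: (integrable_norm (integrable01 cg)).
  - exact: (integrableD _ ic ig2').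
  move=> x _; rewrite -real_normK ?num_real//.
  have -> : s / 2 + (2 * s)^-1 * `|g x| ^+ 2 = `|g x| + (s - `|g x|) ^+ 2 / (2 * s).
    by field; rewrite gt_eqF.
  by rewrite lerDl divr_ge0 ?sqr_ge0// mulr_ge0// ltW.
rewrite RintegralD//.
have -> : \int[mu]_(x in `[0, 1]) (s / 2) = s / 2.
  by rewrite Rintegral_cst//= lebesgue_measure_itv/= lte_fin ltr01 oppr0 adde0 mulr1.
rewrite RintegralZl//.
have -> : (1 + C) / 2 * s = s / 2 + (2 * s)^-1 * (C * s ^+ 2).
  by field; rewrite gt_eqF.
by rewrite lerD2l s2 ler_wpM2l// invr_ge0 mulr_ge0// ltW.
Qed.

Context d (Omega : measurableType d) (P : probability Omega R).
Context (m : nat) (n : 'I_m -> nat) (eps : 'I_m -> R) (F t : R) (L : nat).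
Variables (X xi : forall j, 'I_(n j) -> {RV P >-> R}) (W : 'I_m -> {RV P >-> R}).
Hypotheses (n0 : forall j, (0 < n j)%N) (eps0 : forall j, 0 < eps j).
Hypotheses (F0 : 0 <= F) (t0 : 0 <= t) (v0 : 0 < \sum_j raw_weight L (n j) (eps j)).
Hypothesis model :
  sampling_model (fun j => noise_scale B cA (F + t) L (n j) (eps j)) X xi W.

Lemma noise_scale_ge0 j : 0 <= noise_scale B cA (F + t) L (n j) (eps j).
Proof.
rewrite noise_scaleE; apply: mulr_ge0.
  apply: mulr_ge0; last exact: addr_ge0.
  by apply: mulr_ge0; [rewrite mulr_ge0|exact: sqr_ge0].
by rewrite divr_ge0 ?exprn_ge0// mulr_ge0// ltW.
Qed.

Lemma pointwise_risk_le (C x0 : R) (f : R -> R) :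
  {within `[0, 1], continuous f} -> (forall x, 0 <= x <= 1 -> `|f x| <= F) ->
  0 <= C -> 0 <= x0 <= 1 ->
  \int[mu]_(x in `[0, 1]) (wav_kernel B L.+1 x0 x ^+ 2) <= C * 2 ^+ L ->
  (pointwise_risk B eps L (F + t) X xi W x0 f <=
   (2 * (`|wav_expansion B L.+1 (wav_coef B f) x0 - f x0| +
         4 * expR (- (t ^+ 2 / 4)) * ((1 + C) / 2 * Num.sqrt (2 ^+ L))) ^+ 2 +
    2 * ((F + t) ^+ 2 * (C + 16 * (2 * cA%:R * sup_norm (cdv_psi B) ^+ 2) ^+ 2) *
      (2 ^+ L) ^+ 2 / \sum_j raw_weight L (n j) (eps j)))%:E)%E.
Proof.
move=> cf fF C0 x01 gC; set g := wav_kernel B L.+1 x0.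
have cg : {within `[0, 1], continuous g} by exact: wav_expansion_within_continuous.
have [G G0 gG] := bounded_within_segment cg.
have m01 : measurable (`[0, 1]%classic : set R) by exact: measurable_itv.
(* Nothing is known of f and g outside [0, 1]. Their extensions by 0 are bounded and measurable on
   the line, as [averaged_risk_le] requires, and leave the error unchanged since X takes values in
   [0, 1]. *)
pose f0 := f \_ `[0, 1]; pose g0 := g \_ `[0, 1].
have restrE (h : R -> R) x : 0 <= x <= 1 -> (h \_ `[0, 1]) x = h x.
  by move=> xx; rewrite patchE mem_set//= in_itv.
have restr_le (h : R -> R) K : 0 <= K -> (forall x, 0 <= x <= 1 -> `|h x| <= K) ->
    forall x, `|(h \_ `[0, 1]) x| <= K.
  move=> K0 hK x; rewrite patchE; case: ifPn => [|_]; last by rewrite normr0.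
  by rewrite inE/= in_itv/= => /hK.
have mr (h : R -> R) : {within `[0, 1], continuous h} ->
    measurable_fun setT (h \_ `[0, 1]).
  move=> ch; apply/(measurable_restrictT _ m01).
  exact: subspace_continuous_measurable_fun.
have mf0 := mr f cf; have mg0 := mr g cg.
have f0F := restr_le f F F0 fF; have g0G := restr_le g G G0 gG.
have [X01 _ _ _ _] := model.
have := averaged_risk_le model noise_scale_ge0 n0 mf0 mg0 f0F g0G t0
  (weight_ge0 L n0 eps0) (sum_weight v0) (f x0).
have inE01 x : x \in (`[0, 1]%classic : set R) -> 0 <= x <= 1.
  by rewrite inE/= in_itv.
have -> : \int[mu]_(x in `[0, 1]) (f0 x * g0 x) = wav_expansion B L.+1 (wav_coef B f) x0.
  rewrite -inner01_wav_kernel//; apply: eq_Rintegral => x /inE01 xx.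
  by rewrite /f0 /g0 !restrE.
have -> : \int[mu]_(x in `[0, 1]) `|g0 x| = \int[mu]_(x in `[0, 1]) `|g x|.
  by apply: eq_Rintegral => x /inE01 xx; rewrite /g0 restrE.
have -> : \int[mu]_(x in `[0, 1]) (g0 x ^+ 2) = \int[mu]_(x in `[0, 1]) (g x ^+ 2).
  by apply: eq_Rintegral => x /inE01 xx; rewrite /g0 restrE.
have -> : averaged_error X xi W f0 g0 F t (weight L n eps) (f x0) =
    pointwise_error B eps L (F + t) X xi W x0 f.
  apply/funext => w; rewrite /averaged_error /pointwise_error /estimator /transcript.
  congr (_ - _); apply: eq_bigr => j _; rewrite local_estimateE.
  congr (_ * (_ * _ + _)); apply: eq_bigr => i _.
  by rewrite /clipped_product/= /f0 /g0 !restrE.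
rewrite -/(pointwise_risk B eps L (F + t) X xi W x0 f); move=> h.
apply: (le_trans h); rewrite lee_fin; apply: lerD.
  have e0 : 0 <= 4 * expR (- (t ^+ 2 / 4)) by rewrite mulr_ge0// expR_ge0.
  have s0 : 0 <= (1 + C) / 2 * Num.sqrt (2 ^+ L).
    by rewrite mulr_ge0 ?sqrtr_ge0// divr_ge0// addr_ge0.
  rewrite ler_wpM2l// ler_pXn2r ?nnegrE//.
  - by rewrite lerD2l ler_wpM2l//; exact: wav_kernel_norm.
  - by apply: addr_ge0 => //; apply: mulr_ge0 => //; exact: Rintegral_ge0.
  - by apply: addr_ge0 => //; exact: mulr_ge0.
rewrite ler_wpM2l//.
set c := 2 * cA%:R * _; set tau := F + t.
(* [c1] is the sampling part, from the kernel norm; [c2] is the Laplace part, with the 16 of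
   [laplace_sqr_le]. *)
have := weighted_variance_le n0 eps0 (c1 := tau ^+ 2 * C) (c2 := 16 * (c * tau) ^+ 2)
  (mulr_ge0 (sqr_ge0 _) C0) (mulr_ge0 (ler0n _ _) (sqr_ge0 _)) v0.
have -> : tau ^+ 2 * C + 16 * (c * tau) ^+ 2 = tau ^+ 2 * (C + 16 * c ^+ 2) by ring.
apply: le_trans; apply: ler_sum => j _; apply: ler_wpM2l; first exact: sqr_ge0.
apply: lerD; last by rewrite noise_scaleE -/c -/tau [X in 16 * X]exprMn mulrA.
rewrite ler_wpM2r ?invr_ge0// -mulrA ler_wpM2l ?sqr_ge0//.
Qed.

End PointwiseRisk.

(** * Logarithms and the choice of the resolution level *)

Section Logarithms.
Context {R : realType}.

Lemma ln2_le1 : ln 2 <= 1 :> R.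
Proof. by have := @le_ln1Dx R 1; rewrite -[1 + 1]/(2%:R : R); apply; lra. Qed.

(** Bounds 1 / ln 2 by 2 when log2 D is compared with [ln N]; it holds since e^(-1/2) >= 1 - 1/2. *)
Lemma ln2_ge_half : 2^-1 <= ln 2 :> R.
Proof.
rewrite -ler_expR lnK ?posrE// -[2^-1]opprK expRN.
rewrite -[leRHS]invrK lef_pV2 ?posrE ?expR_gt0// (le_trans _ (expR_ge1Dx _))//.
lra.
Qed.

Lemma expR_le_powR2 (y : R) : 0 <= y -> expR (- y) <= 2 `^ (- y).
Proof.
move=> y0; rewrite /powR pnatr_eq0/= ler_expR mulNr lerN2.
by rewrite ler_piMr// ln2_le1.
Qed.

Lemma expR_ge_nat (a b : R) : expR a <= b -> a <= ln b.
Proof.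
by move=> ab; rewrite -ler_expR lnK// posrE (lt_le_trans _ ab)// expR_gt0.
Qed.

Lemma pow2_ln (L : nat) : 2 ^+ L = expR (L%:R * ln 2) :> R.
Proof. by rewrite expRM_natl lnK// posrE. Qed.

End Logarithms.

Section Resolution.
Context {R : realType} (l0 m : nat) (n : 'I_m -> nat) (eps : 'I_m -> R).
Variables (nu D : R) (L : nat).
Hypotheses (nu0 : 2^-1 < nu) (D0 : 0 < D).
Hypothesis DE : D `^ (2 * nu + 2) =
  \sum_(j < m) Num.min ((n j)%:R ^+ 2 * eps j ^+ 2) ((n j)%:R * D).
Hypothesis LE : L%:Z = Num.max l0.+1%:Z (Num.ceil (ln D / ln 2)).

Let ln2_gt0 : 0 < ln 2 :> R.
Proof. exact: lt_le_trans ln2_ge_half. Qed.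

Lemma resolution_ge : D <= 2 ^+ L.
Proof.
rewrite pow2_ln -[leLHS]lnK ?posrE// ler_expR -ler_pdivrMr//.
rewrite (le_trans (ceil_ge _))// -[L%:R]/((L%:Z)%:~R) ler_int LE.
by rewrite le_max lexx orbT.
Qed.

Lemma resolution_gt_l0 : (l0 < L)%N.
Proof. by rewrite -lez_nat LE le_max lexx. Qed.

(** In the second case 2^L is comparable to [D]; in the first it may be much larger, but L is then a
    constant of the basis. *)
Lemma resolution_cases : L = l0.+1 \/ L%:R < ln D / ln 2 + 1.
Proof.
have [h|h] := leP (Num.ceil (ln D / ln 2)) l0.+1%:Z.
  by left; apply/eqP; rewrite -eqz_nat LE; apply/eqP/max_idPl.
right; have := ceilB1_lt (ln D / ln 2).
have -> : Num.ceil (ln D / ln 2) = L%:Z.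
  by rewrite LE; apply/esym/max_idPr; exact: ltW.
by rewrite intrD mulrN1z ltrBlDr.
Qed.

Lemma resolution_le2 : L%:R < ln D / ln 2 + 1 -> 2 ^+ L <= 2 * D.
Proof.
move=> h; rewrite pow2_ln -[leRHS]lnK ?posrE ?mulr_gt0// ler_expR lnM ?posrE//.
by rewrite -ler_pdivlMr// mulrDl divff ?gt_eqF// addrC ltW.
Qed.

(** The weights are capped at n_j 2^L, the equation for [D] at n_j D; rounding up makes the former
    cap the larger one. *)
Lemma sum_raw_weight_ge : D `^ (2 * nu + 2) <= \sum_j raw_weight L (n j) (eps j).
Proof.
rewrite DE; apply: ler_sum => j _; rewrite /raw_weight le_min ge_min lexx/=.
by rewrite ge_min ler_wpM2l ?resolution_ge// orbT.
Qed.

(** Keeping only the arm n_j D of each minimum gives D^(2 nu + 2) <= N D. *)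
Lemma resolution_ln : (2 * nu + 1) * ln D <= ln (\sum_(j < m) n j)%N%:R.
Proof.
set N := (\sum_(j < m) n j)%N%:R.
have DN : D `^ (2 * nu + 2) <= N * D.
  rewrite DE /N natr_sum mulr_suml; apply: ler_sum => j _.
  by rewrite ge_min lexx orbT.
have N0 : 0 < N.
  by rewrite -(pmulr_lgt0 _ D0) (lt_le_trans _ DN)// powR_gt0.
have : ln (D `^ (2 * nu + 2)) <= ln (N * D).
  by rewrite ler_ln ?posrE ?powR_gt0// mulr_gt0.
rewrite ln_powR lnM ?posrE//; lra.
Qed.

(** The sum of the weights is at least D^(2 nu + 2) >= (2^L / k)^(2 nu + 2), and 2 L - L (2 nu + 2)
    = - 2 L nu. The parameter [k] is the overshoot allowed for 2^L over [D]. *)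
Lemma resolution_variance k : 0 <= k -> 2 ^+ L <= k * D ->
  (2 ^+ L) ^+ 2 / \sum_j raw_weight L (n j) (eps j) <=
  k `^ (2 * nu + 2) * ((2 `^ (- nu)) ^+ L) ^+ 2.
Proof.
move=> k0 Lk; set s := 2 * nu + 2; set V := \sum_j _.
have Ds : 0 < D `^ s by exact: powR_gt0.
have V0 : 0 < V by exact: lt_le_trans sum_raw_weight_ge.
have s0 : 0 <= s.
  by rewrite addr_ge0// mulr_ge0// ltW// (lt_trans _ nu0)// invr_gt0.
rewrite ler_pdivrMr// (le_trans _ (ler_wpM2l _ sum_raw_weight_ge))//; last first.
  by rewrite mulr_ge0 ?powR_ge0 ?sqr_ge0.
rewrite -/s mulrAC -powRM ?(ltW D0)//.
have : (2 ^+ L) `^ s <= (k * D) `^ s.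
  by apply: ge0_ler_powR; rewrite ?nnegrE ?exprn_ge0 ?mulr_ge0 ?(ltW D0).
move=> /(ler_wpM2r (sqr_ge0 ((2 `^ (- nu)) ^+ L))); apply: le_trans.
rewrite le_eqVlt; apply/orP; left; apply/eqP.
rewrite -!powR_mulrn ?powR_ge0// -!powRrM -powRD; last by rewrite pnatr_eq0 implybT.
by congr (_ `^ _); rewrite /s; ring.
Qed.

End Resolution.

(** [Cpsi] precedes the class, while [N0] follows the class and precedes the servers: a large N may
    pay for class constants, uniformly over configurations. The bound [c0 <= D] gives one overshoot
    2^(l0 + 1) / c0 for all configurations in which L is held at l0 + 1. *)
Theorem theorem3p4 (R : realType) (B : cdv_data R)
    (hB : cdv_basis B) (cA : nat) (hcA : overlap_bound B cA) :
  exists2 Cpsi : R, 0 < Cpsi &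
  forall (alpha nu : R) (p q : \bar R) (r Cnu Ceps c0 : R),
    alpha < (cdv_A B)%:R ->
    (2%:E <= p)%E -> (1%:E <= q)%E ->
    nu = alpha - inv_exponent p -> 2^-1 < nu ->
    0 < r ->
    0 < Cnu ->
    (forall f, besov_ball B alpha p q r f ->
       forall x, 0 <= x <= 1 -> `|f x| <= Cnu) ->
    0 < Ceps -> 0 < c0 ->
  exists N0 : nat,
  forall (m : nat) (n : 'I_m -> nat) (eps : 'I_m -> R) (x0 D tau : R)
    (L : nat),
    (forall j, (0 < n j)%N) ->
    (forall j, 0 < eps j <= Ceps) ->
    0 < x0 < 1 ->
    0 < D ->
    D `^ (2 * nu + 2) =
      \sum_(j < m) Num.min ((n j)%:R ^+ 2 * eps j ^+ 2) ((n j)%:R * D) ->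
    L%:Z = Num.max (cdv_l0 B).+1%:Z (Num.ceil (ln D / ln 2)) ->
    tau = Cnu + Num.sqrt (2 * (2 * nu + 1) * L%:R) ->
    c0 <= D ->
    (N0 <= \sum_(j < m) n j)%N ->
  forall (d : measure_display) (Omega : measurableType d)
    (P : probability Omega R)
    (X xi : forall j, 'I_(n j) -> {RV P >-> R}) (W : 'I_m -> {RV P >-> R}),
    sampling_model (fun j => noise_scale B cA tau L (n j) (eps j)) X xi W ->
    (ereal_sup [set pointwise_risk B eps L tau X xi W x0 f
               | f in besov_ball B alpha p q r]
     <= (Cpsi * ln (\sum_(j < m) n j)%N%:R * 2 `^ (- (2 * L%:R * nu)))%:E)%E.
Proof.
have [KE KE0 hKE] := wav_expansion_error hB hcA.
have [CK CK0 hCK] := wav_kernel_sqr_norm hB hcA.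
(* The kernel runs over the levels below L + 1, so its squared norm is at most CK 2^(L + 1). *)
pose C := 2 * CK; have C0 : 0 <= C by rewrite mulr_ge0// ltW.
pose C3 := C + 16 * (2 * cA%:R * sup_norm (cdv_psi B) ^+ 2) ^+ 2.
have C30 : 0 <= C3 by rewrite addr_ge0// mulr_ge0// sqr_ge0.
(* [Q] replaces 2^(2 nu + 2) by a constant of the basis, since nu <= alpha < A. *)
pose A : R := (cdv_A B)%:R; pose Q := 2 `^ (2 * A + 2).
have Q0 : 0 <= Q by exact: powR_ge0.
(* 16 is the factor 2 of the risk bound times the 8 in tau^2 <= T2 + 8 ln N; the summand 1 pays for
   all class constants, through K1 <= ln N. *)
exists (16 * C3 * Q + 1); first by rewrite ltr_wpDl// !mulr_ge0.
move=> alpha nu p q r Cnu Ceps c0 alphaA p2 q1 nuE nu_half r0 Cnu0 hCnu _ c0_gt0.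
have nu0 : 0 < nu by apply: lt_trans nu_half; rewrite invr_gt0.
have nuA : 2 * nu + 2 <= 2 * A + 2.
  have : 0 <= inv_exponent p.
    by rewrite invr_ge0 fine_ge0// (le_trans _ p2)// lee_fin.
  by move: alphaA; rewrite nuE -/A; lra.
pose rho := 2 `^ (- nu); pose l0 := cdv_l0 B.
(* [K0] is the constant of the squared bias. [T1] and [Q1] are the threshold and the overshoot
   factor when L = l0 + 1; [T2] is the part of tau^2 free of [ln N] in the other case. [K1] adds up
   both cases. *)
pose K0 := 2 * (KE * r / (1 - rho) + 2 * (1 + C)) ^+ 2.
pose T1 := Cnu + Num.sqrt (2 * (2 * nu + 1) * l0.+1%:R).
pose Q1 := (2 ^+ l0.+1 / c0) `^ (2 * nu + 2).
pose T2 := 2 * Cnu ^+ 2 + 4 * (2 * nu + 1).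
pose K1 := K0 + 2 * C3 * Q * T2 + 2 * C3 * Q1 * T1 ^+ 2.
have rho0 : 0 <= rho by exact: powR_ge0.
have rho1 : rho < 1.
  rewrite /rho powRN invf_lt1 ?powR_gt0//.
  have := gt0_ltr_powR nu0 (x := 1) (y := 2); rewrite powR1 !nnegrE.
  by apply; rewrite ?ltr1n.
have T20 : 0 <= T2.
  apply: addr_ge0; first by rewrite mulr_ge0// sqr_ge0.
  by rewrite mulr_ge0// addr_ge0// mulr_ge0// ltW.
have Q10 : 0 <= Q1 by exact: powR_ge0.
have K10 : 0 <= 2 * C3 * Q * T2 by rewrite !mulr_ge0.
have K20 : 0 <= 2 * C3 * Q1 * T1 ^+ 2.
  by apply: mulr_ge0; [rewrite !mulr_ge0|exact: sqr_ge0].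
exists (Num.truncn (expR K1)).+1 => m n eps x0 D tau L n0 heps x01 D0 DE LE tauE c0D NN0.
move=> d Omega P X xi W model.
set N := (\sum_(j < m) n j)%N%:R : R.
have lnN : K1 <= ln N.
  by apply: expR_ge_nat; rewrite (le_trans (ltW (Num.Theory.truncnS_gt _)))// ler_nat.
have eps0 j : 0 < eps j by have /andP[] := heps j.
set t := Num.sqrt _ in tauE; have t0 : 0 <= t by exact: sqrtr_ge0.
have t2 : t ^+ 2 = 2 * (2 * nu + 1) * L%:R.
  by rewrite sqr_sqrtr// !mulr_ge0// addr_ge0// mulr_ge0// ltW.
have V0 : 0 < \sum_j raw_weight L (n j) (eps j).
  by rewrite (lt_le_trans _ (sum_raw_weight_ge D0 DE LE))// powR_gt0.
have x01' : 0 <= x0 <= 1 by case/andP: x01 => a b; rewrite !ltW.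
apply: ge_ereal_sup => _ [f fB <-]; have [cf _] := fB.
rewrite tauE in model *.
have gC : \int[lebesgue_measure]_(x in `[0, 1]) (wav_kernel B L.+1 x0 x ^+ 2) <= C * 2 ^+ L.
  by apply: (le_trans (hCK L.+1 x0 x01')); rewrite /C exprS mulrCA mulrA.
apply: (le_trans (pointwise_risk_le hB n0 eps0 (ltW Cnu0) t0 V0 model cf (hCnu f fB)
  C0 x01' gC)).
rewrite lee_fin -/C3 -/N; set V := \sum_j _ in V0 *.
have -> : 2 `^ (- (2 * L%:R * nu)) = (rho ^+ L) ^+ 2.
  by rewrite -!powR_mulrn ?powR_ge0// -!powRrM; congr (_ `^ _); ring.
set rL := rho ^+ L; have rL0 : 0 <= rL by exact: exprn_ge0.
have bias1 : `|wav_expansion B L.+1 (wav_coef B f) x0 - f x0| <= KE * r / (1 - rho) * rL.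
  apply: (le_trans (hKE nu r f x0 L.+1 nu0 (ltW r0) cf _ x01 _)).
  - by move=> l k l0l kl; exact: (besov_coef_le p2 q1 nuE fB l0l kl).
  - by rewrite ltnW// ltnS ltnW// (resolution_gt_l0 LE).
  rewrite -/rho mulrAC ler_wpM2l//; last by rewrite exprS ler_piMl// ltW.
  by rewrite divr_ge0 ?mulr_ge0 ?subr_ge0// ltW.
have bias2 : 4 * expR (- (t ^+ 2 / 4)) * ((1 + C) / 2 * Num.sqrt (2 ^+ L)) <=
    2 * (1 + C) * rL.
  (* The threshold is designed for this exponent: 1/2 cancels the growth 2^(L / 2) of the L1 norm of
     the kernel, and nu leaves the rate. *)
  have -> : t ^+ 2 / 4 = L%:R * (nu + 2^-1) by rewrite t2; field.
  have e1 := @expR_le_powR2 R (L%:R * (nu + 2^-1)).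
  have /e1 {}e1 : 0 <= L%:R * (nu + 2^-1) by rewrite mulr_ge0// addr_ge0 ?invr_ge0// ltW.
  have := ler_wpM2r (sqrtr_ge0 (2 ^+ L)) e1; rewrite powR2_level -/rho -/rL => e2.
  have -> : 4 * expR (- (L%:R * (nu + 2^-1))) * ((1 + C) / 2 * Num.sqrt (2 ^+ L)) =
    2 * (1 + C) * (expR (- (L%:R * (nu + 2^-1))) * Num.sqrt (2 ^+ L)) by field.
  by rewrite ler_wpM2l// mulr_ge0// addr_ge0.
have bias : 2 * (`|wav_expansion B L.+1 (wav_coef B f) x0 - f x0| +
    4 * expR (- (t ^+ 2 / 4)) * ((1 + C) / 2 * Num.sqrt (2 ^+ L))) ^+ 2 <= K0 * rL ^+ 2.
  rewrite /K0 -[leRHS]mulrA -exprMn ler_wpM2l// ler_pXn2r ?nnegrE//.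
  - by rewrite [leRHS]mulrDl lerD.
  - by rewrite addr_ge0// !mulr_ge0 ?expR_ge0 ?sqrtr_ge0 ?invr_ge0// addr_ge0.
  - rewrite mulr_ge0// addr_ge0//; last by rewrite mulr_ge0// addr_ge0.
    by rewrite divr_ge0 ?mulr_ge0 ?subr_ge0// ltW.
have variance k : 0 <= k -> 2 ^+ L <= k * D ->
    2 * ((Cnu + t) ^+ 2 * C3 * (2 ^+ L) ^+ 2 / V) <=
    2 * C3 * k `^ (2 * nu + 2) * (Cnu + t) ^+ 2 * rL ^+ 2.
  move=> k0 Lk; have := resolution_variance nu_half D0 DE LE k0 Lk.
  rewrite -/V -/rho -/rL => h.
  have c0' : 0 <= 2 * ((Cnu + t) ^+ 2 * C3).
    by rewrite mulr_ge0//; apply: mulr_ge0 => //; exact: sqr_ge0.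
  have := ler_wpM2l c0' h; set lhs := _ * (_ / V); set rhs := _ * (_ * rL ^+ 2).
  have -> : lhs = 2 * ((Cnu + t) ^+ 2 * C3 * (2 ^+ L) ^+ 2 / V) by rewrite /lhs !mulrA.
  by have -> : rhs = 2 * C3 * k `^ (2 * nu + 2) * (Cnu + t) ^+ 2 * rL ^+ 2
    by rewrite /rhs; ring.
have lnN0 : 0 <= ln N by apply: le_trans lnN; rewrite /K1 !addr_ge0// mulr_ge0// sqr_ge0.
(* Both regimes of L reduce to exhibiting an overshoot [k]; with the bias constant added, K1 + 16 C3
   Q ln N remains. *)
suff [k [k0 Lk kN]] : exists k, [/\ 0 <= k, 2 ^+ L <= k * D &
    2 * C3 * k `^ (2 * nu + 2) * (Cnu + t) ^+ 2 <= K1 - K0 + 16 * C3 * Q * ln N].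
  apply: (le_trans (lerD bias (variance k k0 Lk))).
  rewrite -mulrDl ler_wpM2r ?sqr_ge0// mulrDl mul1r.
  by move: kN lnN; lra.
have [LEl0|Lln] := resolution_cases LE.
  exists (2 ^+ l0.+1 / c0); split.
  - by rewrite divr_ge0 ?exprn_ge0// ltW.
  - by rewrite LEl0 -mulrA ler_peMr ?exprn_ge0// mulrC ler_pdivlMr// mul1r.
  rewrite /t LEl0 -/T1 -/Q1 /K1.
  have : 0 <= 16 * C3 * Q * ln N by rewrite !mulr_ge0.
  lra.
(* Rounding log2 D up at most doubles [D]. *)
exists 2; split => //; first exact: resolution_le2.
have kQ : 2 `^ (2 * nu + 2) <= Q by rewrite /Q ler_powR// ler1n.
(* 2 t^2 = 4 (2 nu + 1) L, and (2 nu + 1) L <= 2 nu + 1 + 2 ln N: hence the 8 and the second term of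
   [T2]. *)
have tau2 : (Cnu + t) ^+ 2 <= T2 + 8 * ln N.
  apply: (@le_trans _ _ (2 * Cnu ^+ 2 + 2 * t ^+ 2)).
    have := sqr_ge0 (Cnu - t); lra.
  rewrite t2 /T2.
  have h1 := resolution_ln D0 DE; rewrite -/N in h1.
  have h2 := @ln2_ge_half R.
  have l2 : 0 < ln 2 :> R by exact: lt_le_trans h2.
  have nu1 : 0 <= 2 * nu + 1 by lra.
  have h3 : (2 * nu + 1) * L%:R <= 2 * nu + 1 + 2 * ln N.
    apply: (le_trans (ler_wpM2l nu1 (ltW Lln))).
    rewrite mulrDr mulr1 addrC lerD2l mulrA ler_pdivrMr// (le_trans h1)//.
    rewrite mulrAC ler_peMl//; lra.
  lra.
have := ler_pM (powR_ge0 2 (2 * nu + 2)) (sqr_ge0 (Cnu + t)) kQ tau2.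
move=> /(ler_wpM2l (mulr_ge0 (ler0n R 2) C30)); rewrite mulrA => h.
apply: (le_trans h).
have -> : K1 - K0 + 16 * C3 * Q * ln N =
    2 * C3 * (Q * (T2 + 8 * ln N)) + 2 * C3 * Q1 * T1 ^+ 2 by rewrite /K1; ring.
by rewrite lerDl.
Qed.
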